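(* Let $(X,N)$ be the Markov modulated Poisson model described in the context. For $0\le s\le t$ and $u\in\mathbb R$ let $\phi_{t|s}=\mathbb E[\exp(\mathrm iuN_t)X_t\mid\mathcal F_s]$. Then $$\phi_{t|s}=\exp\Big(\big((e^{\mathrm iu}-1)\,\mathrm{diag}(\lambda)+Q\big)(t-s)\Big)\,e^{\mathrm iuN_s}X_s.$$
   Context: $X$ is a continuous-time Markov chain with values in the set $\{e_1,\dots,e_d\}$ of standard basis vectors of $\mathbb R^d$, with irreducible transition matrix $Q\in\mathbb R^{d\times d}$; convention: $Q_{ij}$, $i\neq j$, is the intensity of a transition from state $j$ to state $i$, so column sums of $Q$ are zero and $\mathrm dX_t=QX_t\,\mathrm dt+\mathrm dM^X_t$ with $M^X$ a martingale. Let $\lambda\in\mathbb R^d_+$. $N$ is a counting process with $N_0=0$ which, conditionally on the whole process $X$, is a Poisson process with time-varying intensity $\lambda^\top X_t$; in particular, given $\mathcal F^X$, $N_t$ is Poisson with parameter $\int_0^t\lambda^\top X_s\,\mathrm ds$, and $\mathrm dN_t=\lambda^\top X_t\,\mathrm dt+\mathrm dm_t$ with $m$ a martingale. $X$ and $N$ have a.s. no simultaneous jumps. $(\mathcal F_t)$ is the filtration generated by $X$ and $N$. $\mathrm{diag}(\lambda)$ is the diagonal matrix with diagonal $\lambda$. *)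

(* Defs.v *)
From HB Require Import structures.
From mathcomp Require Import all_boot all_order all_algebra.
From mathcomp Require Import complex.
From mathcomp Require Import all_classical all_reals all_analysis.

Set Implicit Arguments.
Unset Strict Implicit.
Unset Printing Implicit Defensive.

Import Order.TTheory GRing.Theory Num.Theory.
Import numFieldNormedType.Exports.

Local Open Scope classical_set_scope.
Local Open Scope complex_scope.
Local Open Scope ring_scope.

(* Time is R; every condition on a process only concerns times t >= 0. *)

Section linear_algebra.
Context {R : realType}.

(* The limit is taken for the normed-module topology of 'M[C]_d. *)
Definition expmx {C : numFieldType} {d : nat} (A : 'M[C]_d) : 'M[C]_d :=
  lim (series (fun k : nat => (k`!%:R)^-1 *: A ^+ k) n @[n --> \oo]).

Definition expi (x : R) : R[i] := cos x +i* sin x.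

Definition complex_mx {m n : nat} (A : 'M[R]_(m, n)) : 'M[R[i]]_(m, n) :=
  map_mx (fun x : R => x%:C) A.

(* Q i j is the intensity of the transition from j to i, so columns, not
   rows, sum to zero. *)
Record is_rate_matrix {d : nat} (Q : 'M[R]_d) : Prop := IsRateMatrix {
  rate_offdiag : forall i j : 'I_d, i != j -> 0 <= Q i j ;
  rate_colsum : forall j : 'I_d, \sum_i Q i j = 0 }.

Definition irreducible_rate {d : nat} (Q : 'M[R]_d) : Prop :=
  forall i j : 'I_d, connect (fun a b : 'I_d => 0 < Q b a) i j.

(* p h i j is the probability of being in i a time h after having been in j;
   the last field says that Q i j is the intensity of the transition j -> i. *)
Record is_transition_function {d : nat} (Q : 'M[R]_d) (p : R -> 'M[R]_d)
    : Prop := IsTransitionFunction {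
  transition_ge0 : forall h, 0 <= h -> forall i j, 0 <= p h i j ;
  transition_colsum : forall h, 0 <= h -> forall j, \sum_i p h i j = 1 ;
  transition0 : p 0 = 1%:M ;
  transitionD : forall g h, 0 <= g -> 0 <= h -> p (g + h) = p g *m p h ;
  transition_generator :
    (fun h : R => h^-1 *: (p h - 1%:M)) @ 0^'+ --> Q }.

End linear_algebra.

Section paths.
Context {R : realType} {U : ptopologicalType}.

Definition cadlag (f : R -> U) : Prop :=
  (forall t, 0 <= t -> f @ t^'+ --> f t) /\
  (forall t, 0 < t -> cvg (f @ t^'-)).

Definition jumps_at (f : R -> U) (t : R) : Prop := f t <> lim (f @ t^'-).

End paths.

Definition counting_path {R : realType} (f : R -> nat) : Prop :=
  [/\ f 0 = 0%N, cadlag f &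
      forall t, 0 < t -> jumps_at f t -> f t = (lim (f @ t^'-)).+1].

Section generated_sigma_algebras.
Context {R : realType} {T : Type}.

(* The singletons suffice to generate the sigma-algebra of Y because Y takes
   countably many values in all uses below. *)
Definition history {U : Type} (Y : R -> T -> U) (I : set R) : set (set T) :=
  [set A | exists t y, I t /\ A = Y t @^-1` [set y]].

Definition sigma_upto {U : Type} (Y : R -> T -> U) (s : R) : set (set T) :=
  <<s history Y `[0, s] >>.

Definition sigma_all {U : Type} (Y : R -> T -> U) : set (set T) :=
  <<s history Y `[0, +oo[ >>.

Definition joint_filtration {U V : Type} (X : R -> T -> U) (N : R -> T -> V)
    (s : R) : set (set T) :=
  <<s history X `[0, s] `|` history N `[0, s] >>.

End generated_sigma_algebras.

Section conditional_expectation.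
Context {R : realType} {dis : measure_display} {T : measurableType dis}.
Variable P : probability T R.

(* Z is a version of E[Y | G], for a sigma-algebra G of measurable sets. *)
Record is_condexp (G : set (set T)) (Y Z : T -> R) : Prop := IsCondexp {
  condexp_integrand : P.-integrable setT (EFin \o Y) ;
  condexp_integrable : P.-integrable setT (EFin \o Z) ;
  condexp_measurable : forall B : set R, measurable B -> G (Z @^-1` B) ;
  condexp_integral : forall A, G A ->
    (\int[P]_(w in A) (Z w)%:E = \int[P]_(w in A) (Y w)%:E)%E }.

Definition is_condexp_vec {d : nat} (G : set (set T))
    (Y Z : T -> 'cV[R[i]]_d) : Prop :=
  forall j : 'I_d,
    is_condexp G (fun w => complex.Re (Y w j 0)) (fun w => complex.Re (Z w j 0))
    /\
    is_condexp G (fun w => complex.Im (Y w j 0)) (fun w => complex.Im (Z w j 0)).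

End conditional_expectation.

Section processes.
Context {R : realType} {dis : measure_display} {T : measurableType dis}.
Variable P : probability T R.
Context {d : nat}.
Implicit Types (X : R -> T -> 'cV[R]_d) (N : R -> T -> nat).

(* As X t is a standard basis vector, X t w i 0 is the indicator of X t = e_i
   and (p (t - s) *m X s w) i 0 is the probability of going from the state
   X s w to e_i in time t - s. *)
Record is_markov_chain (Q : 'M[R]_d) X : Prop := IsMarkovChain {
  chain_state : forall t w, 0 <= t -> exists j : 'I_d, X t w = delta_mx j 0 ;
  chain_measurable : history X `[0, +oo[ `<=` measurable ;
  chain_cadlag : forall w, cadlag (fun t => X t w) ;
  chain_markov : exists2 p : R -> 'M[R]_d, is_transition_function Q p &
    forall s t, 0 <= s -> s <= t -> forall i : 'I_d,
      is_condexp P (sigma_upto X s)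
        (fun w => X t w i 0) (fun w => (p (t - s) *m X s w) i 0) }.

(* With 0 ^+ 0 = 1, this is the point mass at 0 when r = 0; the library's
   poisson_pmf is 1 for every k in that case. *)
Definition poisson_weight (r : R) (k : nat) : R :=
  r ^+ k / k`!%:R * expR (- r).

Definition cumulated_intensity (lambda : 'cV[R]_d) X (a b : R) (w : T) : R :=
  \int[lebesgue_measure]_(r in `[a, b]) (lambda^T *m X r w) 0 0.

(* Given the whole of X, the increments of N over successive intervals are
   independent, Poisson with parameter the integral of the intensity. *)
Definition conditionally_poisson (lambda : 'cV[R]_d) X N : Prop :=
  forall (n : nat) (tau : nat -> R) (k : nat -> nat),
    0 <= tau 0%N ->
    (forall i : nat, tau i <= tau i.+1) ->
    is_condexp P (sigma_all X)
      (\1_[set w | forall i : nat, (i < n)%N ->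
                     N (tau i.+1) w = (N (tau i) w + k i)%N])
      (fun w => \prod_(i < n)
         poisson_weight (cumulated_intensity lambda X (tau i) (tau i.+1) w)
                        (k i)).

Record is_mmpp (Q : 'M[R]_d) (lambda : 'cV[R]_d) X N : Prop := IsMmpp {
  mmpp_chain : is_markov_chain Q X ;
  mmpp_measurable : history N `[0, +oo[ `<=` measurable ;
  mmpp_counting : forall w, counting_path (fun t => N t w) ;
  mmpp_poisson : conditionally_poisson lambda X N ;
  mmpp_no_common_jump : {ae P, forall w, forall t : R, 0 < t ->
    ~ (jumps_at (fun r => X r w) t /\ jumps_at (fun r => N r w) t)} }.

End processes.

(* Main.v *)
(* Given X, the increments of N are independent Poisson variables, so for an
   event of the past made of an event A of sigma(X_r, r <= s) and of prescribed
   increments of N up to s, the expectation of e^{iu N_t} X_t reduces to one that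
   involves X only: the increments up to s contribute Poisson weights, which are
   bounded and sigma(X_r, r <= s)-measurable, and the increment from s to t
   contributes exp((e^{iu} - 1) L), where L is the integral of lambda^T X over
   [s, t].  What remains is the Feynman-Kac formula
     E[exp((e^{iu} - 1) L) X_t | X up to s]
       = exp((t - s) ((e^{iu} - 1) diag lambda + Q)) X_s.
   Since the paths of X are right-continuous, L is the limit of right-endpoint
   Riemann sums L_n; with L_n in place of L, the Markov property gives exactly
   M_n^n X_s, where M_n = exp((e^{iu} - 1) h diag lambda) p(h), h = (t - s) / n, and
   M_n = 1 + h ((e^{iu} - 1) diag lambda + Q) + o(h).  A pi-lambda argument
   passes from such past events to the whole sigma-algebra. *)

Require Import Defs.
From HB Require Import structures.
From mathcomp Require Import all_boot all_order all_algebra.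
From mathcomp Require Import complex ring lra.
From mathcomp Require Import all_classical all_reals all_analysis measurable_realfun.
Import Order.TTheory GRing.Theory Num.Theory.
Import numFieldNormedType.Exports.
Local Open Scope classical_set_scope.
Local Open Scope complex_scope.
Local Open Scope ring_scope.

Set Implicit Arguments.
Unset Strict Implicit.
Unset Printing Implicit Defensive.

(** * Convergence in R[i] *)

(** The hypothesis on [N] speaks only of increments along a chain of times, tested against events of
    sigma(X). It does not directly concern the values of [N], the variable e^(iu N_t), or events
    that mix [X] and [N], and this shapes the argument. Values become increments because N_0 = 0. On
    an event that also fixes N_s = m, the factor e^(iu N_s) is the constant z^m with z = e^(iu). The
    remaining factor z^(N_t - N_s) is expanded over all values of the last increment. The Poisson
    weights are a detour: they replace the event on increments so that Feynman-Kac, an identity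
    about [X] alone, can be applied, and are then exchanged back for the same event. Conditional
    expectations are handled as equalities E[1_A f] = E[1_A g] for bounded complex f and g, so every
    limit under the expectation is dominated by a constant. The sum of the absolute values of the
    two components replaces the modulus; hence the bound 2, instead of 1, for points of the unit
    circle. *)

Section complex_sequences.
Context {R : realType}.
Implicit Types (x y z : R[i]) (u v : nat -> R[i]).

Lemma complexP x y : complex.Re x = complex.Re y ->
  complex.Im x = complex.Im y -> x = y.
Proof. by case: x => a b; case: y => c e /= -> ->. Qed.

Lemma cRe_sum (I : Type) (r : seq I) (p : pred I) (F : I -> R[i]) :
  complex.Re (\sum_(i <- r | p i) F i) = \sum_(i <- r | p i) complex.Re (F i).
Proof. exact: (big_morph _ (fun x y => raddfD (@complex.Re R : {additive _ -> _}) x y)). Qed.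

Lemma cIm_sum (I : Type) (r : seq I) (p : pred I) (F : I -> R[i]) :
  complex.Im (\sum_(i <- r | p i) F i) = \sum_(i <- r | p i) complex.Im (F i).
Proof. exact: (big_morph _ (fun x y => raddfD (@complex.Im R : {additive _ -> _}) x y)). Qed.

Lemma cReM x y : complex.Re (x * y) =
  complex.Re x * complex.Re y - complex.Im x * complex.Im y.
Proof. by case: x => a b; case: y. Qed.

Lemma cImM x y : complex.Im (x * y) =
  complex.Re x * complex.Im y + complex.Im x * complex.Re y.
Proof. by case: x => a b; case: y. Qed.

(* The library puts no topology on R[i]. *)
Definition ccvg u z :=
  (complex.Re (u n) @[n --> \oo] --> complex.Re z) /\
  (complex.Im (u n) @[n --> \oo] --> complex.Im z).

Lemma ccvg_cst z : ccvg (fun=> z) z.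
Proof. by split; exact: cvg_cst. Qed.

Lemma ccvgD u v x y : ccvg u x -> ccvg v y -> ccvg (fun n => u n + v n) (x + y).
Proof.
by move=> [u1 u2] [v1 v2]; split; under eq_cvg do rewrite raddfD; rewrite raddfD;
  exact: cvgD.
Qed.

Lemma ccvgN u x : ccvg u x -> ccvg (fun n => - u n) (- x).
Proof.
by move=> [u1 u2]; split; under eq_cvg do rewrite raddfN; rewrite raddfN;
  exact: cvgN.
Qed.

Lemma ccvgB u v x y : ccvg u x -> ccvg v y -> ccvg (fun n => u n - v n) (x - y).
Proof. by move=> ux vy; apply: ccvgD => //; exact: ccvgN. Qed.

Lemma ccvgM u v x y : ccvg u x -> ccvg v y -> ccvg (fun n => u n * v n) (x * y).
Proof.
move=> [u1 u2] [v1 v2]; split.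
  under eq_cvg do rewrite cReM; rewrite cReM.
  by apply: cvgB; exact: cvgM.
under eq_cvg do rewrite cImM; rewrite cImM.
by apply: cvgD; exact: cvgM.
Qed.

Lemma ccvg_sum (I : Type) (r : seq I) (u : I -> nat -> R[i]) (z : I -> R[i]) :
  (forall i, ccvg (u i) (z i)) ->
  ccvg (fun n => \sum_(i <- r) u i n) (\sum_(i <- r) z i).
Proof.
move=> uz; elim: r => [|i r IH].
  rewrite big_nil; under [X in ccvg X]funext => n do rewrite big_nil.
  exact: ccvg_cst.
rewrite big_cons; under [X in ccvg X]funext => n do rewrite big_cons.
exact: ccvgD.
Qed.

Lemma ccvg_unique u x y : ccvg u x -> ccvg u y -> x = y.
Proof.
move=> [u1 u2] [v1 v2]; apply: complexP.
  by apply: cvg_unique u1 v1.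
by apply: cvg_unique u2 v2.
Qed.

Lemma eq_ccvg u v z : u =1 v -> ccvg u z -> ccvg v z.
Proof. by move=> /funext ->. Qed.

Lemma ccvg_near u z : (\forall n \near \oo, u n = z) -> ccvg u z.
Proof.
by move=> uz; split; apply: cvg_near_cst; apply: filterS uz => n ->.
Qed.

Lemma ccvg_shift u z : ccvg u z -> ccvg (fun n => u n.+1) z.
Proof. by move=> [u1 u2]; split; rewrite (cvg_shiftS (fun n => _ (u n))). Qed.

Lemma ccvg_real (f : nat -> R) (a : R) :
  f n @[n --> \oo] --> a -> ccvg (fun n => (f n)%:C) a%:C.
Proof. by move=> fa; split => //=; exact: cvg_cst. Qed.

(** The l1 norm of the plane in place of the modulus: it avoids square roots, is still
    submultiplicative, and dominates each component. *)
Definition cabs z : R := `|complex.Re z| + `|complex.Im z|.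

Lemma cabs_ge0 z : 0 <= cabs z.
Proof. by rewrite addr_ge0. Qed.

Lemma cabsD x y : cabs (x + y) <= cabs x + cabs y.
Proof. by rewrite /cabs !raddfD addrACA lerD// ler_normD. Qed.

Lemma cabsM x y : cabs (x * y) <= cabs x * cabs y.
Proof.
rewrite /cabs cReM cImM.
apply: (@le_trans _ _ ((`|complex.Re x * complex.Re y| + `|complex.Im x * complex.Im y|) +
  (`|complex.Re x * complex.Im y| + `|complex.Im x * complex.Re y|))).
  by rewrite lerD ?ler_normB ?ler_normD.
by rewrite !normrM; lra.
Qed.

Lemma cabsN x : cabs (- x) = cabs x.
Proof. by rewrite /cabs !raddfN !normrN. Qed.

Lemma cabs_real (a : R) : cabs a%:C = `|a|.
Proof. by rewrite /cabs/= normr0 addr0. Qed.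

Lemma cabs_sum (I : Type) (r : seq I) (F : I -> R[i]) :
  cabs (\sum_(i <- r) F i) <= \sum_(i <- r) cabs (F i).
Proof.
elim: r => [|i r IH]; first by rewrite !big_nil /cabs/= normr0 addr0.
by rewrite !big_cons (le_trans (cabsD _ _))// lerD2l.
Qed.

Lemma ccvg_cabs u z : ccvg u z <-> cabs (u n - z) @[n --> \oo] --> 0.
Proof.
split=> [[u1 u2]|u0].
  have dist0 (f : nat -> R) l : f n @[n --> \oo] --> l -> `|f n - l| @[n --> \oo] --> 0.
    by move=> fl; apply/norm_cvg0P; rewrite -(subrr l); apply: cvgB fl (cvg_cst _).
  rewrite -[0]addr0; apply: cvgD; under eq_cvg do rewrite raddfB; exact: dist0.
split; apply/cvgrPdist_le => e e0; move/cvgrPdist_le : u0 => /(_ _ e0);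
  apply: filterS => n; rewrite sub0r normrN ger0_norm ?cabs_ge0//;
  apply: le_trans; rewrite distrC -raddfB /cabs ?lerDl ?lerDr//.
Qed.

Lemma ccvg0_cabs u : ccvg u 0 <-> cabs (u n) @[n --> \oo] --> 0.
Proof. by rewrite ccvg_cabs; under eq_cvg do rewrite subr0. Qed.

(** In the order of [R[i]] a positive [e] is real, and the modulus is at most [cabs]. This passes
    from [cabs] to the norm in which the limit defining [expmx] is taken. *)
Lemma normc_lt z (e : R[i]) : 0 < e -> cabs z < complex.Re e -> `|z| < e.
Proof.
case: z e => a b [e f]; rewrite /cabs/= ltcE/= => /andP[/eqP -> e0] abe.
rewrite normc_def/= ltcR -[ltRHS]ger0_norm ?(ltW e0)// -sqrtr_sqr ltr_sqrt ?exprn_gt0//.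
have := normr_ge0 a; have := normr_ge0 b.
by rewrite -(real_normK (num_real a)) -(real_normK (num_real b)); nra.
Qed.

End complex_sequences.

(** * The exponential of a complex matrix *)

Section matrix_limit.

Lemma lim_matrix_entries (C : numFieldType) (m n : nat) (F : nat -> 'M[C]_(m, n))
    (L : 'M[C]_(m, n)) :
  (forall e : C, 0 < e -> \forall k \near \oo, forall i j, `|L i j - F k i j| < e) ->
  lim (F k @[k --> \oo]) = L.
Proof.
move=> FL; apply: cvg_lim; first exact: norm_hausdorff.
apply/cvg_ballP => e e0; have := FL e e0; apply: filterS => k Fk; split=> //.
Qed.

End matrix_limit.

Section exponential.
Context {R : realType}.
Variable d : nat.
Implicit Types (A B M : 'M[R[i]]_d) (a b : R).

(* A bound on the operator norm for the supremum norm, with cabs in place of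
   the modulus. *)
Definition mxbound A a := 0 <= a /\ forall i, \sum_j cabs (A i j) <= a.

Lemma mxbound1 : mxbound 1%:M 1.
Proof.
split=> // i; rewrite (bigD1 i)//= big1 ?addr0 => [|j ji].
  by rewrite mxE eqxx cabs_real normr1.
by rewrite mxE eq_sym (negbTE ji) cabs_real normr0.
Qed.

Lemma mxboundD A B a b : mxbound A a -> mxbound B b -> mxbound (A + B) (a + b).
Proof.
move=> [a0 Aa] [b0 Bb]; split=> [|i]; first exact: addr_ge0.
apply: le_trans (lerD (Aa i) (Bb i)); rewrite -big_split/=.
by apply: ler_sum => j _; rewrite mxE cabsD.
Qed.

Lemma mxboundM A B a b : mxbound A a -> mxbound B b -> mxbound (A *m B) (a * b).
Proof.
move=> [a0 Aa] [b0 Bb]; split=> [|i]; first exact: mulr_ge0.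
apply: (@le_trans _ _ (\sum_j \sum_k cabs (A i k) * cabs (B k j))).
  apply: ler_sum => j _; rewrite mxE (le_trans (cabs_sum _ _))//.
  by apply: ler_sum => k _; exact: cabsM.
rewrite exchange_big/=; apply: le_trans (ler_wpM2r b0 (Aa i)).
rewrite mulr_suml; apply: ler_sum => k _.
by rewrite -mulr_sumr ler_wpM2l ?cabs_ge0.
Qed.

Lemma mxboundZ (c : R) A a : 0 <= c -> mxbound A a -> mxbound (c%:C *: A) (c * a).
Proof.
move=> c0 [a0 Aa]; split=> [|i]; first exact: mulr_ge0.
apply: le_trans (ler_wpM2l c0 (Aa i)); rewrite mulr_sumr.
by apply: ler_sum => j _; rewrite mxE (le_trans (cabsM _ _))// cabs_real ger0_norm.
Qed.

Lemma mxboundX A a n : mxbound A a -> mxbound (A ^+ n) (a ^+ n).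
Proof.
move=> Aa; elim: n => [|n IH]; first by rewrite !expr0; exact: mxbound1.
by rewrite !exprS; exact: mxboundM.
Qed.

Lemma mxbound_sum (I : Type) (r : seq I) (F : I -> 'M[R[i]]_d) (f : I -> R) :
  (forall i, mxbound (F i) (f i)) -> mxbound (\sum_(i <- r) F i) (\sum_(i <- r) f i).
Proof.
move=> Ff; elim: r => [|i r IH]; last by rewrite !big_cons; exact: mxboundD.
rewrite !big_nil; split=> // i; rewrite big1// => j _.
by rewrite mxE /cabs/= normr0 addr0.
Qed.

Lemma le_mxbound A a b : a <= b -> mxbound A a -> mxbound A b.
Proof.
by move=> ab [a0 Aa]; split=> [|i]; [exact: le_trans ab|exact: le_trans (Aa i) ab].
Qed.

Lemma cabs_le_mxbound A a i j : mxbound A a -> cabs (A i j) <= a.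
Proof.
move=> [_ /(_ i)]; apply: le_trans.
by rewrite (bigD1 j)//= lerDl sumr_ge0// => k _; exact: cabs_ge0.
Qed.

Lemma ex_mxbound A : exists a, mxbound A a.
Proof.
exists (\sum_i \sum_j cabs (A i j)); split=> [|i].
  by apply: sumr_ge0 => i _; apply: sumr_ge0 => j _; exact: cabs_ge0.
rewrite [leRHS](bigD1 i)//= lerDl sumr_ge0// => k _.
by apply: sumr_ge0 => j _; exact: cabs_ge0.
Qed.

(** Induction on A^(n+1) - B^(n+1) = A (A^n - B^n) + (A - B) B^n. The sharp estimate has a^(n-1);
    [1 <= a] allows the simpler a^n. *)
Lemma mxbound_expB A B a e n : mxbound A a -> mxbound B a -> mxbound (A - B) e ->
  1 <= a -> mxbound (A ^+ n - B ^+ n) (n%:R * (e * a ^+ n)).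
Proof.
move=> Aa Ba ABe a1; have e0 := ABe.1; have a0 := Aa.1.
elim: n => [|n IH].
  rewrite !expr0 subrr mul0r; split=> // i; rewrite big1// => j _.
  by rewrite mxE /cabs/= normr0 addr0.
rewrite !exprS (_ : _ - _ = A *m (A ^+ n - B ^+ n) + (A - B) *m B ^+ n); last first.
  by rewrite mulmxBr mulmxBl -!/(_ * _) addrA subrK.
apply: le_mxbound (mxboundD (mxboundM Aa IH) (mxboundM ABe (mxboundX n Ba))).
rewrite -natr1 mulrDl mul1r lerD//; first by rewrite [leLHS]mulrCA [a * (e * _)]mulrCA.
by rewrite ler_wpM2l// ler_peMl// exprn_ge0.
Qed.

Definition expmx_sum A (n : nat) := series (fun k : nat => (k`!%:R)^-1 *: A ^+ k) n.

Lemma natr_complexE (n : nat) : n%:R = (n%:R : R)%:C.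
Proof. by rewrite rmorph_nat. Qed.

(** For a bound [a] of [A], each entry of A^k / k! is at most a^k / k! in [cabs], so the real and
    imaginary series converge absolutely by comparison with the series of exp a. *)
Lemma expmx_sum_cvg A i j : exists l, ccvg (fun n => expmx_sum A n i j) l.
Proof.
have [a Aa] := ex_mxbound A; have a0 := Aa.1.
pose t k := ((k`!%:R)^-1 *: A ^+ k) i j.
have ta k : cabs (t k) <= exp_coeff a k.
  apply: cabs_le_mxbound; rewrite /exp_coeff/= natr_complexE -fmorphV/= mulrC.
  by apply: mxboundZ; [rewrite invr_ge0|exact: mxboundX].
have tE n : expmx_sum A n i j = \sum_(0 <= k < n) t k.
  by rewrite /expmx_sum /series/= summxE.
have cv (f : nat -> R) : (forall k, `|f k| <= exp_coeff a k) -> cvgn (series f).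
  move=> fa; apply: normed_cvg.
  apply: (@series_le_cvg _ _ (exp_coeff a)) => [n|n|n|].
  - exact: normr_ge0.
  - exact: exp_coeff_ge0.
  - exact: fa.
  - exact: is_cvg_series_exp_coeff.
have /cvg_ex[l1 h1] : cvgn (series (fun k => complex.Re (t k))).
  by apply: cv => k; apply: le_trans (ta k); rewrite /cabs lerDl.
have /cvg_ex[l2 h2] : cvgn (series (fun k => complex.Im (t k))).
  by apply: cv => k; apply: le_trans (ta k); rewrite /cabs lerDr.
exists (l1 +i* l2); split.
  by under eq_cvg do rewrite tE cRe_sum; exact: h1.
by under eq_cvg do rewrite tE cIm_sum; exact: h2.
Qed.

Lemma expmx_cvg A i j : ccvg (fun n => expmx_sum A n i j) (expmx A i j).
Proof.
have /choice[L HL] : forall ij : 'I_d * 'I_d, exists l,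
    ccvg (fun n => expmx_sum A n ij.1 ij.2) l.
  by move=> ij; exact: expmx_sum_cvg.
suff -> : expmx A = \matrix_(i, j) L (i, j) by rewrite mxE; exact: (HL (i, j)).
apply: lim_matrix_entries => e e0; apply: filter_forall => k; apply: filter_forall => l.
have /ccvg_cabs/cvgrPdist_lt := HL (k, l).
have e0' : 0 < complex.Re e by move: e0; rewrite ltcE => /andP[].
move=> /(_ _ e0'); apply: filterS => n; rewrite sub0r normrN ger0_norm ?cabs_ge0// => h.
by apply: normc_lt => //; rewrite mxE -cabsN opprB.
Qed.

(** With y = a / (n+1), the inequality 1 + x <= e^x at x = y and at x = -y / (1 + y) encloses 1 + y
    between exp(y / (1 + y)) and exp y. Raising to the power n+1 gives the bounds exp(a / (1 + y))
    and exp a. *)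
Lemma cvg_exp_pow a : 0 <= a ->
  (1 + n.+1%:R^-1 * a) ^+ n.+1 @[n --> \oo] --> expR a.
Proof.
move=> a0; apply: (@squeeze_cvgr _ _ _ _ (fun n => expR (a / (1 + n.+1%:R^-1 * a)))
    (fun=> expR a)).
- apply: nearW => n; have n0 : 0 < n.+1%:R^-1 :> R by rewrite invr_gt0.
  set y := _^-1 * a; have y0 : 0 <= y by rewrite mulr_ge0// ltW.
  apply/andP; split.
    rewrite (_ : a / (1 + y) = n.+1%:R * (y / (1 + y))); last first.
      by rewrite /y !mulrA divff ?mul1r.
    rewrite expRM_natl lerXn2r ?nnegrE ?expR_ge0 ?addr_ge0//.
    have := expR_ge1Dx (- (y / (1 + y))).
    rewrite (_ : 1 + - (y / (1 + y)) = (1 + y)^-1); last by field; rewrite gt_eqF// ltr_wpDr.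
    by rewrite expRN lef_pV2// posrE ?expR_gt0// ltr_wpDr.
  rewrite (_ : a = n.+1%:R * y) ?expRM_natl; last by rewrite /y mulrA divff ?mul1r.
  by rewrite lerXn2r ?nnegrE ?expR_ge0 ?addr_ge0// expR_ge1Dx.
- apply: continuous_cvg; first exact: continuous_expR.
  rewrite -[X in _ --> X]divr1; apply: cvgM; first exact: cvg_cst.
  apply: cvgV; first exact: oner_neq0.
  rewrite -[X in _ --> X]addr0; apply: cvgD; first exact: cvg_cst.
  by rewrite -[X in _ --> X](mul0r a); apply: cvgM; [exact: cvg_harmonic|exact: cvg_cst].
- exact: cvg_cst.
Qed.

(** Multiplied by k!, the binomial becomes the falling factorial n (n-1) ... (n-k+1), a product of k
    factors at most n. For n = 0 the inverse is 0 by convention, and this case is treated apart. *)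
Lemma bin_div_le (n k : nat) : 'C(n, k)%:R * (n%:R : R)^-1 ^+ k <= k`!%:R^-1.
Proof.
have f0 : 0 < k`!%:R :> R by rewrite ltr0n fact_gt0.
rewrite -[leRHS]mul1r ler_pdivlMr// mulrAC -natrM bin_ffact.
have [->|n0] := posnP n.
  case: k {f0} => [|k]; first by rewrite expr0 mulr1 ffactn0.
  by rewrite ffact0n mul0r.
rewrite exprVn ler_pdivrMr ?exprn_gt0 ?ltr0n// mul1r -natrX ler_nat.
elim: k {f0} => [|k IH]; first by rewrite ffactn0 expn0.
by rewrite ffactnSr expnSr leq_mul// leq_subr.
Qed.

(* The library's exprZn needs an algebra, that is, a positive dimension. *)
Lemma scalemxX (c : R[i]) A n : (c *: A) ^+ n = c ^+ n *: A ^+ n.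
Proof.
elim: n => [|n IH]; first by rewrite !expr0 scale1r.
by rewrite !exprS IH -[_ * _]/(_ *m _) -scalemxAl -scalemxAr scalerA.
Qed.

Lemma expmx_sum_pow A a n : mxbound A a ->
  mxbound (expmx_sum A n.+1 - (1 + (n%:R : R)^-1%:C *: A) ^+ n)
          (series (exp_coeff a) n.+1 - (1 + n%:R^-1 * a) ^+ n).
Proof.
move=> Aa; pose c k : R := k`!%:R^-1 - 'C(n, k)%:R * n%:R^-1 ^+ k.
have c0 k : 0 <= c k by rewrite subr_ge0 bin_div_le.
rewrite addrC [1 + _ * a]addrC addrC [1 + _]addrC !exprD1n.
rewrite /expmx_sum /series/= !big_mkord -!sumrB.
rewrite (eq_bigr (fun k : 'I_n.+1 => (c k)%:C *: A ^+ k)) => [|k _]; last first.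
  rewrite scalemxX scalerMnl -scalerBl; congr (_ *: _).
  by rewrite -[_ *+ 'C(_, _)]mulr_natl /c rmorphB rmorphM rmorphXn !fmorphV !rmorph_nat.
rewrite [X in mxbound _ X](eq_bigr (fun k : 'I_n.+1 => c k * a ^+ k)) => [|k _]; last first.
  by rewrite /c mulrBl exprMn -mulr_natl /exp_coeff/= mulrA [_^-1 * _]mulrC.
by apply: mxbound_sum => k; apply: mxboundZ => //; exact: mxboundX.
Qed.

(* Termwise, the partial sums of exp A minus the powers (1 + A / n) ^ n have
   nonnegative coefficients on the A ^ k, so their difference is dominated by
   the same difference for a scalar, which vanishes in the limit. *)
Lemma expmx_limit A (M : nat -> 'M[R[i]]_d) (e : nat -> R) i j :
  (forall n, mxbound (M n - (1 + (n.+1%:R : R)^-1%:C *: A)) (e n)) ->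
  (n.+1%:R * e n @[n --> \oo] --> 0) ->
  ccvg (fun n => (M n ^+ n.+1) i j) (expmx A i j).
Proof.
move=> Me e0; have [a Aa] := ex_mxbound A; have a0 := Aa.1.
pose P n := 1 + (n.+1%:R : R)^-1%:C *: A.
have Pa n : mxbound (P n) (1 + n.+1%:R^-1 * a).
  by apply: mxboundD; [exact: mxbound1|exact: mxboundZ].
have cvP : ccvg (fun n => (expmx_sum A n.+2 - P n ^+ n.+1) i j) 0.
  apply/ccvg0_cabs; apply: (@squeeze_cvgr _ _ _ _ (fun=> 0)
    (fun n => series (exp_coeff a) n.+2 - (1 + n.+1%:R^-1 * a) ^+ n.+1)).
  - apply: nearW => n; rewrite cabs_ge0/=; apply: cabs_le_mxbound.
    exact: expmx_sum_pow.
  - exact: cvg_cst.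
  - rewrite -(subrr (expR a)); apply: cvgB; last exact: cvg_exp_pow.
    rewrite (cvg_shiftS (fun n => series (exp_coeff a) n.+1)) cvg_shiftS.
    exact: is_cvg_series_exp_coeff.
have cvM : ccvg (fun n => (M n ^+ n.+1 - P n ^+ n.+1) i j) 0.
  apply/ccvg0_cabs; apply: (@squeeze_cvgr _ _ _ _ (fun=> 0)
    (fun n => n.+1%:R * e n * expR (a + 1))).
  (* Once [n.+1%:R * e n <= 1], both [M n] and [P n] are bounded by 1 + (a + 1) / (n+1): [P n]
     accounts for [a], the error for the extra 1. The power n+1 of this bound is at most exp(a +
     1). *)
  - move/cvgrPdist_le : e0 => /(_ 1 ltr01); apply: filterS => n.
    rewrite sub0r normrN => en1; rewrite cabs_ge0/=; apply: cabs_le_mxbound.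
    have n0 : 0 < n.+1%:R^-1 :> R by rewrite invr_gt0.
    have en : e n <= n.+1%:R^-1.
      rewrite -[leRHS]mulr1 mulrC ler_pdivlMr// mulrC.
      exact: le_trans (ler_norm _) en1.
    have bM : mxbound (M n) (1 + n.+1%:R^-1 * (a + 1)).
      rewrite (_ : M n = (M n - P n) + P n); last by rewrite subrK.
      apply: le_mxbound (mxboundD (Me n) (Pa n)).
      by rewrite addrC -addrA lerD2l mulrDr mulr1 lerD2l.
    have bP : mxbound (P n) (1 + n.+1%:R^-1 * (a + 1)).
      by apply: le_mxbound (Pa n); rewrite lerD2l ler_pM2l// lerDl.
    have b1 : 1 <= 1 + n.+1%:R^-1 * (a + 1).
      by rewrite lerDl mulr_ge0 ?(ltW n0)// addr_ge0.
    apply: le_mxbound (mxbound_expB n.+1 bM bP (Me n) b1).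
    rewrite -mulrA ler_wpM2l// ler_wpM2l ?(Me n).1//.
    rewrite [X in expR X](_ : _ = n.+1%:R * (n.+1%:R^-1 * (a + 1))); last first.
      by rewrite mulrA divff ?mul1r.
    by rewrite expRM_natl lerXn2r ?nnegrE ?expR_ge0 ?(le_trans ler01)// expR_ge1Dx.
  - exact: cvg_cst.
  - by rewrite -(mul0r (expR (a + 1))); apply: cvgM => //; exact: cvg_cst.
rewrite (_ : expmx A i j = 0 - 0 + expmx A i j); last by rewrite subrr add0r.
have /ccvg_shift/ccvg_shift/= := expmx_cvg A i j.
move=> /(ccvgD (ccvgB cvM cvP)); apply: eq_ccvg => n.
by rewrite !mxE; ring.
Qed.

End exponential.

(** * The Poisson characteristic function *)

Section poisson_generating_function.
Context {R : realType}.
Implicit Types (u v r x y : R).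

Lemma eq_cvgn (f g : nat -> R) (l : R) :
  f =1 g -> f n @[n --> \oo] --> l -> g n @[n --> \oo] --> l.
Proof. by move=> /funext ->. Qed.

(** The derivative at 0 is read along the sequence v / (n+1). It is a limit over punctured
    neighbourhoods, which the sequence respects only for v different from 0. *)
Lemma cvg_quotient (f : R -> R) (df v : R) : is_derive (0 : R) (1 : R) f df ->
  n.+1%:R * (f (n.+1%:R^-1 * v) - f 0) @[n --> \oo] --> v * df.
Proof.
move=> [fd <-]; have [->|v0] := eqVneq v 0.
  by rewrite mul0r; under eq_cvg do rewrite mulr0 subrr mulr0; exact: cvg_cst.
move: fd; rewrite /derivable => /cvg_ex[l hl].
have -> : 'D_1 f 0 = l by apply: cvg_lim.
have h0 : n.+1%:R^-1 * v @[n --> \oo] --> (0 : R).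
  by rewrite -(mul0r v); apply: cvgM; [exact: cvg_harmonic|exact: cvg_cst].
have /cvgr_dnbhsP/(_ (fun n => n.+1%:R^-1 * v)) := hl.
move=> /(_ _)/(cvgM (cvg_cst v)) H.
apply: eq_cvgn (H _) => [n|].
  rewrite /= addr0 [_ *: 1]mulr1 /GRing.scale/= invfM invrK mulrA.
  by rewrite [v * _]mulrCA divff// mulr1.
by split=> // n; rewrite mulf_neq0// invr_neq0.
Qed.

Lemma expiD x y : expi (x + y) = expi x * expi y.
Proof. by apply: complexP; rewrite /= ?cReM ?cImM /= ?cosD ?sinD; ring. Qed.

Lemma expi0 : expi (0 : R) = 1.
Proof. by rewrite /expi cos0 sin0. Qed.

Lemma expi_natr x n : expi (x * n%:R) = expi x ^+ n.
Proof.
elim: n => [|n IH]; first by rewrite mulr0 expi0.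
by rewrite -natr1 mulrDr mulr1 expiD IH exprSr.
Qed.

Lemma cabs_expi x : cabs (expi x) <= 2.
Proof.
by rewrite /cabs/= (_ : 2 = 1 + 1)// lerD// ler_norml ?cos_geN1 ?cos_le1 ?sin_geN1 ?sin_le1.
Qed.

Lemma expi_quotient v :
  ccvg (fun n => (n.+1%:R : R)%:C * (expi (n.+1%:R^-1 * v) - 1)) (0 +i* v).
Proof.
split.
  have := @cvg_quotient cos _ v (is_derive_cos 0); rewrite sin0 oppr0 mulr0.
  apply: eq_cvgn => n.
  by rewrite cReM/= cos0 mul0r subr0.
have := @cvg_quotient sin _ v (is_derive_sin 0); rewrite cos0 mulr1.
apply: eq_cvgn => n.
by rewrite cImM/= sin0 mul0r addr0 subr0.
Qed.

Definition cexp (z : R[i]) : R[i] := (expR (complex.Re z))%:C * expi (complex.Im z).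

Lemma cexpD (z w : R[i]) : cexp (z + w) = cexp z * cexp w.
Proof. by rewrite /cexp !raddfD/= expRD expiD rmorphM/=; ring. Qed.

Lemma cexp0 : cexp 0 = 1.
Proof. by rewrite /cexp expR0 expi0 mulr1. Qed.

Lemma cexpMn (z : R[i]) n : cexp (n%:R * z) = cexp z ^+ n.
Proof.
elim: n => [|n IH]; first by rewrite mul0r cexp0.
by rewrite -natr1 mulrDl mul1r cexpD IH exprSr.
Qed.

(** With h = 1 / (n+1), x = Re z and y = Im z, cexp(h z) - 1 = (e^(h x) - 1) e^(i h y) + (e^(i h y)
    - 1), so the real derivatives of exp, cos and sin suffice. The factor e^(i h y) tends to 1
    because its difference quotient converges. *)
Lemma cexp_quotient (z : R[i]) :
  ccvg (fun n => (n.+1%:R : R)%:C * (cexp ((n.+1%:R^-1 : R)%:C * z) - 1)) z.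
Proof.
rewrite [X in ccvg _ X](_ : z = (complex.Re z)%:C * 1 + (0 +i* complex.Im z)); last first.
  by case: z => a b; apply: complexP => /=; ring.
have hE : ccvg (fun n => ((n.+1%:R : R) * (expR (n.+1%:R^-1 * complex.Re z) - 1))%:C)
    (complex.Re z)%:C.
  apply: ccvg_real; have := @cvg_quotient expR _ (complex.Re z) (is_derive_expR 0).
  by rewrite expR0 mulr1.
have h1 : ccvg (fun n => expi (n.+1%:R^-1 * complex.Im z)) 1.
  have nz : ccvg (fun n => (n.+1%:R^-1 : R)%:C) 0.
    by apply: (@ccvg_real _ _ 0); exact: cvg_harmonic.
  rewrite (_ : 1 = 0 * (0 +i* complex.Im z) + 1); last by rewrite mul0r add0r.
  have := ccvgD (ccvgM nz (expi_quotient (complex.Im z))) (ccvg_cst 1).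
  apply: eq_ccvg => n; rewrite mulrA -rmorphM mulVf//.
  by rewrite rmorph1 mul1r subrK.
apply: eq_ccvg (ccvgD (ccvgM hE h1) (expi_quotient (complex.Im z))) => n.
rewrite /cexp cReM cImM/= mul0r mul0r subr0 addr0 rmorphM rmorphB/=.
by ring.
Qed.

(** The series is that of [expmx] for the 1 x 1 matrix [z]. With [M n] the scalar matrix cexp(z /
    (n+1)), the powers [M n ^+ n.+1] are constantly cexp z, so [expmx_limit] identifies the two
    exponentials. *)
Lemma cexp_series (z : R[i]) :
  ccvg (fun n => \sum_(k < n) (k`!%:R^-1 * z ^+ k)) (cexp z).
Proof.
pose A : 'M[R[i]]_1 := z%:M.
have AX (w : R[i]) n : (w%:M : 'M[R[i]]_1) ^+ n = (w ^+ n)%:M by rewrite rmorphXn.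
have -> : cexp z = expmx A 0 0.
  pose M n : 'M[R[i]]_1 := (cexp ((n.+1%:R^-1 : R)%:C * z))%:M.
  have ME n : (M n - (1 + (n.+1%:R : R)^-1%:C *: A)) =
      (cexp ((n.+1%:R^-1 : R)%:C * z) - 1 - (n.+1%:R : R)^-1%:C * z)%:M.
    by apply/matrixP => a b; rewrite !ord1 !mxE eqxx !mulr1n; ring.
  apply: (@ccvg_unique _ (fun n => (M n ^+ n.+1) 0 0)).
    apply: eq_ccvg (ccvg_cst _) => n.
    rewrite /M AX mxE eqxx mulr1n -cexpMn natr_complexE mulrA -rmorphM.
    by rewrite divff ?pnatr_eq0// rmorph1 mul1r.
  apply: (@expmx_limit _ _ _ _ (fun n =>
    cabs (cexp ((n.+1%:R^-1 : R)%:C * z) - 1 - (n.+1%:R : R)^-1%:C * z))) => [n|].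
    split=> [|i]; first exact: cabs_ge0.
    by rewrite ME big_ord1 !ord1 mxE.
  have /ccvg_cabs := cexp_quotient z; apply: eq_cvgn => n.
  have n0 : (n.+1%:R : R) != 0 by rewrite pnatr_eq0.
  set w := cexp _ - 1.
  rewrite (_ : _ - z = (n.+1%:R : R)%:C * (w - (n.+1%:R^-1 : R)%:C * z)); last first.
    rewrite [RHS]mulrBr; congr (_ - _).
    by rewrite mulrA -[_ * _%:C]rmorphM divff// rmorph1 mul1r.
  by rewrite /cabs !cReM !cImM /= !mul0r subr0 addr0 !normrM ger0_norm// mulrDr.
have := expmx_cvg A 0 0; apply: eq_ccvg => n.
rewrite /expmx_sum /series/= summxE big_mkord; apply: eq_bigr => k _.
by rewrite AX !mxE eqxx mulr1n.
Qed.

Lemma poisson_gf u r :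
  ccvg (fun n => \sum_(k < n) (expi u ^+ k * (poisson_weight r k)%:C))
       (cexp (r%:C * (expi u - 1))).
Proof.
have -> : cexp (r%:C * (expi u - 1)) = cexp (r%:C * expi u) * (expR (- r))%:C.
  rewrite mulrBr mulr1 cexpD; congr (_ * _).
  by rewrite /cexp/= oppr0 expi0 mulr1.
apply: eq_ccvg (ccvgM (cexp_series _) (ccvg_cst _)) => n.
rewrite mulr_suml; apply: eq_bigr => k _.
rewrite exprMn /poisson_weight !rmorphM fmorphV rmorph_nat rmorphXn/=; ring.
Qed.

Lemma poisson_weight_ge0 r k : 0 <= r -> 0 <= poisson_weight r k.
Proof. by move=> r0; rewrite !mulr_ge0 ?expR_ge0 ?invr_ge0 ?exprn_ge0. Qed.

Lemma poisson_weight_le1 r k : 0 <= r -> poisson_weight r k <= 1.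
Proof.
move=> r0; rewrite /poisson_weight expRN ler_pdivrMr ?expR_gt0// mul1r.
case: k => [|k]; first by rewrite expr0 divr1 -[leLHS]addr0 (le_trans _ (expR_ge1Dx _))// lerD2l.
by apply: le_trans (expR_ge1Dxn k r0); rewrite lerDr.
Qed.

(** The partial sums are nondecreasing and tend to 1, by [poisson_gf] at u = 0. The bound later
    dominates the expansion over the values of the last increment. *)
Lemma sum_poisson_weight_le r n : 0 <= r -> \sum_(k < n) poisson_weight r k <= 1.
Proof.
move=> r0; have [+ _] := poisson_gf 0 r.
rewrite expi0 subrr mulr0 cexp0/= => cv.
have {}cv : \sum_(k < m) poisson_weight r k @[m --> \oo] --> (1 : R).
  apply: eq_cvgn cv => m; rewrite cRe_sum; apply: eq_bigr => k _.
  by rewrite expr1n mul1r.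
rewrite -(cvg_lim _ cv)//; apply: nondecreasing_cvgn_le => //.
  apply/nondecreasing_seqP => m; rewrite big_ord_recr/= lerDl.
  exact: poisson_weight_ge0.
by apply/cvg_ex; exists 1.
Qed.

End poisson_generating_function.

(** * Riemann sums and path properties *)

Lemma integrable_bounded d (T : measurableType d) (R : realType)
    (mu : {measure set T -> \bar R}) (A : set T) (f : T -> R) (M : R) :
  measurable A -> (mu A < +oo)%E -> measurable_fun A f ->
  (forall x, A x -> `|f x| <= M) -> mu.-integrable A (EFin \o f).
Proof.
move=> mA Aoo mf fM; apply: measurable_bounded_integrable => //.
exists M; split; first exact: num_real.
by move=> y My x Ax; exact: le_trans (fM x Ax) (ltW My).
Qed.

Section riemann_sums.
Context {R : realType}.
Variables (f : R -> R) (a b M : R).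
Hypothesis ab : a < b.
Hypothesis f_right : forall x, a <= x -> f y @[y --> x^'+] --> f x.
Hypothesis f_bound : forall x, a <= x -> 0 <= f x <= M.

Let h n : R := (b - a) / n.+1%:R.
(** The pieces are open on the left and closed on the right, so [step n r] is the value of [f] at a
    point at or to the right of [r] and within [h n] of it: right continuity is all that convergence
    at [r] demands. *)
Let piece n k := `]a + k%:R * h n, a + k.+1%:R * h n]%classic.
Let step n r := \sum_(k < n.+1) f (a + k.+1%:R * h n) * \1_(piece n k) r.

Let h_gt0 n : 0 < h n.
Proof. by rewrite divr_gt0 ?subr_gt0. Qed.

Let h_cvg0 : h n @[n --> \oo] --> 0.
Proof. by rewrite -(mulr0 (b - a)); apply: cvgM; [exact: cvg_cst|exact: cvg_harmonic]. Qed.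

Let grid_ge n k : a <= a + k%:R * h n.
Proof. by rewrite lerDl mulr_ge0// ltW. Qed.

Let grid_le n j k : (j <= k)%N -> a + j%:R * h n <= a + k%:R * h n.
Proof. by move=> jk; rewrite lerD2l ler_pM2r ?ler_nat. Qed.

Let ex_piece n r : a < r <= b -> exists2 k, (k < n.+1)%N & piece n k r.
Proof.
move=> /andP[ar rb].
suff H m : r <= a + m%:R * h n -> exists2 k, (k < m)%N & piece n k r.
  by apply: H; rewrite /h mulrCA divff ?pnatr_eq0// mulr1 subrKC.
elim: m => [|m IH]; first by rewrite mul0r addr0 leNgt ar.
have [/IH[k km kr] _|rm rm1] := leP r (a + m%:R * h n).
  by exists k => //; exact: ltnW.
by exists m => //; rewrite /piece/= in_itv/= rm.
Qed.

Let stepE n k r : (k < n.+1)%N -> piece n k r -> step n r = f (a + k.+1%:R * h n).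
Proof.
move=> kn pkr; have := pkr; rewrite /piece/= in_itv/= => /andP[kr rk].
rewrite /step (bigD1 (Ordinal kn))//= big1 ?addr0; first by rewrite indicE mem_set ?mulr1.
move=> j; rewrite -val_eqE/= => jk; rewrite indicE memNset ?mulr0// /piece/= in_itv/=.
apply/negP; rewrite negb_and -leNgt -ltNge.
have [jk'|kj|/eqP] := ltngtP j k; last by rewrite (negbTE jk).
- by apply/orP; right; apply: le_lt_trans kr; exact: grid_le.
- by apply/orP; left; apply: le_trans rk _; exact: grid_le.
Qed.

Let step_cvg r : a < r <= b -> step n r @[n --> \oo] --> f r.
Proof.
move=> arb; have ar : a <= r by case/andP: arb => /ltW.
apply/cvgrPdist_lt => e e0.
have /cvgrPdist_lt/(_ _ e0) := f_right ar.
move=> [/= d d0 rd].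
move/cvgrPdist_lt : h_cvg0 => /(_ _ d0); apply: filterS => n.
rewrite sub0r normrN gtr0_norm// => hd.
have [k kn kr] := ex_piece n arb.
rewrite (stepE kn kr); move: kr; rewrite /piece/= in_itv/= => /andP[kr rk].
move: rk; rewrite le_eqVlt => /predU1P[<-|rk]; first by rewrite subrr normr0.
apply: rd => //=; rewrite /ball_/= ltr0_norm ?subr_lt0// opprB.
apply: le_lt_trans hd; rewrite lerBlDl -natr1 mulrDl mul1r addrA lerD2r.
exact: ltW.
Qed.

Let measurable_step n : measurable_fun `]a, b] (step n).
Proof.
apply: measurable_sum => k; apply: measurable_funM => //.
by apply: measurable_indic; exact: measurable_itv.
Qed.

Lemma measurable_right_continuous : measurable_fun `]a, b] f.
Proof.
apply: (measurable_fun_cvg measurable_step) => r /=.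
by rewrite in_itv/=; exact: step_cvg.
Qed.

Let mu := @lebesgue_measure R.

Let integral_step n : (\int[mu]_(r in `]a, b]) (step n r)%:E =
  (\sum_(k < n.+1) h n * f (a + k.+1%:R * h n))%:E)%E.
Proof.
have f0 k : 0 <= f (a + k%:R * h n) by have /andP[] := f_bound (grid_ge n k).
under eq_integral do rewrite /step -sumEFin.
rewrite ge0_integral_sum//=; first last.
- by move=> k r _; rewrite lee_fin mulr_ge0.
- move=> k; apply/measurable_EFinP; apply: measurable_funM => //.
  by apply: measurable_indic; exact: measurable_itv.
rewrite -sumEFin; apply: eq_bigr => k _.
under eq_integral do rewrite EFinM.
rewrite ge0_integralZl_EFin//; last first.
  apply/measurable_EFinP.
  by apply: measurable_indic; exact: measurable_itv.
rewrite integral_indic//=; last exact: measurable_itv.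
rewrite setIidl => [|r]; last first.
  rewrite /piece/= !in_itv/= => /andP[kr rk]; rewrite (le_lt_trans (grid_ge n k))//=.
  apply: le_trans rk _; rewrite -[leRHS](subrKC a) lerD2l.
  rewrite /h mulrCA ler_piMr ?subr_ge0 ?(ltW ab)// ler_pdivrMr// mul1r ler_nat.
  exact: ltn_ord.
rewrite /piece lebesgue_measure_itv/= lte_fin ltrD2l ltr_pM2r// ltr_nat ltnSn.
by rewrite -EFinB -EFinM; congr EFin; rewrite -natr1; ring.
Qed.

Lemma riemann_sum_cvg : \sum_(k < n.+1) h n * f (a + k.+1%:R * h n) @[n --> \oo] -->
  \int[mu]_(r in `[a, b]) f r.
Proof.
have M0 : 0 <= M by have /andP[/le_trans] := f_bound (lexx a); apply.
have fin : (mu `]a, b] < +oo)%E.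
  by rewrite /mu lebesgue_measure_itv/= lte_fin ab -EFinD ltry.
have iM : mu.-integrable `]a, b] (EFin \o cst M).
  by apply: (@integrable_bounded _ _ _ _ _ _ M) => // r _ /=; rewrite ger0_norm.
have iF : mu.-integrable `]a, b] (EFin \o f).
  apply: (@integrable_bounded _ _ _ _ _ _ M) => //.
    exact: measurable_right_continuous.
  by move=> r; rewrite /= in_itv/= => /andP[/ltW/f_bound/andP[f0 fM] _]; rewrite ger0_norm.
(* A point is null; without [a] the interval is exactly the union of the pieces. *)
rewrite -Rintegral_itv_obnd_cbnd//.
have cv : (\int[mu]_(r in `]a, b]) (step n r)%:E)%E @[n --> \oo] -->
    (\int[mu]_(r in `]a, b]) (f r)%:E)%E.
  apply: (@dominated_cvg _ _ _ mu _ _ _ _ (EFin \o cst M)) => //.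
  - by move=> n; apply/measurable_EFinP; exact: measurable_step.
  - move=> r; rewrite /= in_itv/= => abr; apply: cvg_EFin; last exact: step_cvg.
    exact: nearW.
  - move=> n r /=; rewrite in_itv/= => /(ex_piece n)[k kn kr].
    by rewrite (stepE kn kr) lee_fin; have /andP[f0] := f_bound (grid_ge n k.+1);
      rewrite ger0_norm.
move: cv; rewrite -[X in _ --> X]fineK; last exact: integrable_fin_num.
by move=> /fine_cvg; apply: eq_cvgn => n; rewrite /= integral_step.
Qed.

End riemann_sums.

Section counting_paths.
Context {R : realType}.

(** Continuous induction: [c] is the supremum of the points up to which [f] stays at least [f a].
    Limits in [nat] are eventually attained, so the left limit at [c] is at least [f a], and a jump
    there only adds 1. If c < b, [f] is constant just to the right of [c], and [c] could be
    passed. *)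
Lemma counting_path_le (f : R -> nat) (a b : R) :
  counting_path f -> 0 <= a -> a <= b -> (f a <= f b)%N.
Proof.
move=> [_ [fright fleft] fjump] a0 ab.
pose S := [set x | a <= x <= b /\ forall y, a <= y <= x -> (f a <= f y)%N].
have Sa : S a.
  by split=> [|y /le_anti <-]; rewrite ?lexx.
have supS : has_sup S.
  by split; [exists a|exists b => x [/andP[]]].
pose c := sup S.
have ac : a <= c by apply: ub_le_sup => //; exact: supS.2.
have cb : c <= b by apply: ge_sup; [exists a|move=> x [/andP[]]].
have before y : a <= y -> y < c -> (f a <= f y)%N.
  move=> ay yc.
  have cy0 : 0 < c - y by rewrite subr_gt0.
  have [x [_ Sx]] := sup_adherent cy0 supS.
  by rewrite subKr => yx; apply: Sx; rewrite ay ltW.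
have fac : (f a <= f c)%N.
  have [<-//|ac'] := eqVneq a c.
  have {}ac' : a < c by rewrite lt_neqAle ac' ac.
  have c0 : 0 < c by exact: le_lt_trans ac'.
  have /cvg_ex[l fl] := fleft c c0.
  have limE : lim (f @ c^'-) = l by apply: cvg_lim => //; exact: discrete_hausdorff.
  have al : (f a <= l)%N.
    have near_l : \forall y \near c^'-, f y = l by move/discrete_cvg : fl.
    have [y [[yl ay] yc]] : exists y, (f y = l /\ a <= y) /\ y < c.
      apply: (@filter_ex _ c^'-); apply: filterI (nbhs_left_lt c).
      exact: filterI near_l (nbhs_left_ge ac').
    by rewrite -yl; exact: before.
  have [fcl|fcl] := eqVneq (f c) l; first by rewrite fcl.
  rewrite (fjump c c0) ?limE; first exact: leqW.
  by rewrite /jumps_at limE; exact/eqP.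
have [->//|cb'] := eqVneq b c.
have {}cb' : c < b by rewrite lt_neqAle eq_sym cb' cb.
have near_c : \forall y \near c^'+, f y = f c.
  by have /discrete_cvg := fright c (le_trans a0 ac).
have [/= e e0 ce] := near_c.
pose x := Num.min b (c + e / 2).
have cx : c < x by rewrite lt_min cb' ltrDl divr_gt0.
suff Sx : S x by have := ub_le_sup supS.2 Sx; rewrite leNgt cx.
split=> [|y /andP[ay yx]].
  by rewrite (le_trans ac (ltW cx))/= ge_min lexx.
have [yc|cy|->//] := ltgtP y c; first exact: before.
rewrite (ce y)//= /ball_/= distrC ger0_norm ?subr_ge0 ?(ltW cy)// ltrBlDl.
apply: le_lt_trans yx _; rewrite gt_min; apply/orP; right.
by rewrite ltrD2l ltr_pdivrMr// ltr_pMr// ltr1n.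
Qed.

End counting_paths.

(** * Expectation of bounded complex random variables *)

Section complex_expectation.
Context {R : realType} {dis : measure_display} {T : measurableType dis}.
Variable P : probability T R.
Implicit Types (f g : T -> R[i]) (A B : set T).

(** Boundedness is carried instead of integrability because it is stable under products and supplies
    constant dominating functions. *)
Definition bounded_measurable f :=
  [/\ measurable_fun setT (fun w => complex.Re (f w)),
      measurable_fun setT (fun w => complex.Im (f w)) &
      exists M, forall w, cabs (f w) <= M].

Local Notation bmf := bounded_measurable.

Lemma bmf_cst z : bmf (fun=> z).
Proof. by split; [exact: measurable_cst|exact: measurable_cst|exists (cabs z)]. Qed.

Lemma bmf_real (h : T -> R) (M : R) : measurable_fun setT h ->
  (forall w, `|h w| <= M) -> bmf (fun w => (h w)%:C).
Proof.
move=> mh hM; split => //=.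
by exists M => w; rewrite cabs_real.
Qed.

Lemma bmfD f g : bmf f -> bmf g -> bmf (fun w => f w + g w).
Proof.
move=> [f1 f2 [M fM]] [g1 g2 [N gN]]; split.
- by under eq_fun do rewrite raddfD; exact: measurable_funD.
- by under eq_fun do rewrite raddfD; exact: measurable_funD.
- by exists (M + N) => w; rewrite (le_trans (cabsD _ _))// lerD.
Qed.

Lemma bmfM f g : bmf f -> bmf g -> bmf (fun w => f w * g w).
Proof.
move=> [f1 f2 [M fM]] [g1 g2 [N gN]]; split.
- under eq_fun do rewrite cReM.
  by apply: measurable_funB; exact: measurable_funM.
- under eq_fun do rewrite cImM.
  by apply: measurable_funD; exact: measurable_funM.
- exists (M * N) => w; rewrite (le_trans (cabsM _ _))//.
  by rewrite ler_pM ?cabs_ge0.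
Qed.

Lemma bmf_sum (I : Type) (r : seq I) (F : I -> T -> R[i]) :
  (forall i, bmf (F i)) -> bmf (fun w => \sum_(i <- r) F i w).
Proof.
move=> bF; elim: r => [|i r IH].
  by under eq_fun do rewrite big_nil; exact: bmf_cst.
by under eq_fun do rewrite big_cons; exact: bmfD.
Qed.

Lemma bmf_prod (I : Type) (r : seq I) (F : I -> T -> R[i]) :
  (forall i, bmf (F i)) -> bmf (fun w => \prod_(i <- r) F i w).
Proof.
move=> bF; elim: r => [|i r IH].
  by under eq_fun do rewrite big_nil; exact: bmf_cst.
by under eq_fun do rewrite big_cons; exact: bmfM.
Qed.

Definition cind A (w : T) : R[i] := (\1_A w)%:C.

Lemma bmf_ind A : measurable A -> bmf (cind A).
Proof.
move=> mA; apply: (@bmf_real _ 1); first exact: measurable_indic.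
by move=> w; rewrite indicE; case: (_ \in _); rewrite ?normr1 ?normr0.
Qed.

Lemma cindI A B w : cind (A `&` B) w = cind A w * cind B w.
Proof. by rewrite /cind indicI rmorphM. Qed.

Lemma cindT A w : A w -> cind A w = 1.
Proof. by move=> Aw; rewrite /cind indicE mem_set. Qed.

Lemma cindF A w : ~ A w -> cind A w = 0.
Proof. by move=> Aw; rewrite /cind indicE memNset. Qed.

Lemma bmf_integrable f : bmf f ->
  P.-integrable setT (EFin \o (fun w => complex.Re (f w))) /\
  P.-integrable setT (EFin \o (fun w => complex.Im (f w))).
Proof.
move=> [f1 f2 [M fM]].
have PT : (P setT < +oo)%E by rewrite probability_setT ltry.
by split; apply: (@integrable_bounded _ _ _ _ _ _ M) => // w _;
  apply: le_trans (fM w); rewrite /cabs ?lerDl ?lerDr.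
Qed.

Definition cE f : R[i] :=
  (\int[P]_w complex.Re (f w)) +i* (\int[P]_w complex.Im (f w)).

Lemma cED f g : bmf f -> bmf g -> cE (fun w => f w + g w) = cE f + cE g.
Proof.
move=> /bmf_integrable[f1 f2] /bmf_integrable[g1 g2]; apply: complexP => /=.
  by rewrite -RintegralD//; apply: eq_Rintegral => w _; rewrite raddfD.
by rewrite -RintegralD//; apply: eq_Rintegral => w _; rewrite raddfD.
Qed.

Lemma cEZ z f : bmf f -> cE (fun w => z * f w) = z * cE f.
Proof.
have iZ (a : R) (h : T -> R) : P.-integrable setT (EFin \o h) ->
  P.-integrable setT (EFin \o (fun w => a * h w)).
  by move=> ih; exact: (integrableZl measurableT a ih).
move=> /bmf_integrable[f1 f2]; apply: complexP; rewrite ?cReM ?cImM /=.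
  rewrite -!RintegralZl// -RintegralB//; [|exact: iZ..].
  by apply: eq_Rintegral => w _; rewrite cReM.
rewrite -!RintegralZl// -RintegralD//; [|exact: iZ..].
by apply: eq_Rintegral => w _; rewrite cImM.
Qed.

Lemma cE0 : cE (fun=> 0) = 0.
Proof.
by rewrite -[RHS](mul0r (cE (fun=> 0))) -(cEZ 0 (bmf_cst 0)); congr cE; apply/funext => w; rewrite mul0r.
Qed.

Lemma cE_sum (I : Type) (r : seq I) (F : I -> T -> R[i]) : (forall i, bmf (F i)) ->
  cE (fun w => \sum_(i <- r) F i w) = \sum_(i <- r) cE (F i).
Proof.
move=> bF; elim: r => [|i r IH].
  by under eq_fun do rewrite big_nil; rewrite big_nil cE0.
under eq_fun do rewrite big_cons; rewrite big_cons cED ?IH//.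
exact: bmf_sum.
Qed.

Lemma bmf_cvg (F : nat -> T -> R[i]) f (M : R) : (forall n, bmf (F n)) ->
  (forall n w, cabs (F n w) <= M) -> (forall w, ccvg (F ^~ w) (f w)) -> bmf f.
Proof.
move=> bF FM Ff; split.
- apply: (@measurable_fun_cvg _ _ _ _ (fun n w => complex.Re (F n w))).
    by move=> n; have [] := bF n.
  by move=> w _; have [] := Ff w.
- apply: (@measurable_fun_cvg _ _ _ _ (fun n w => complex.Im (F n w))).
    by move=> n; have [] := bF n.
  by move=> w _; have [] := Ff w.
- exists M => w; have [h1 h2] := Ff w.
  have h : cabs (F n w) @[n --> \oo] --> cabs (f w).
    by apply: cvgD; apply: cvg_norm.
  by rewrite -(cvg_lim _ h)//; apply: limr_le; [apply/cvg_ex; exists (cabs (f w))|exact: nearW].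
Qed.

Lemma cE_cvg (F : nat -> T -> R[i]) f (M : R) : (forall n, bmf (F n)) ->
  (forall n w, cabs (F n w) <= M) -> (forall w, ccvg (F ^~ w) (f w)) ->
  ccvg (fun n => cE (F n)) (cE f).
Proof.
move=> bF FM Ff; have bf := bmf_cvg bF FM Ff.
have key (h : R[i] -> R) : (forall z, `|h z| <= cabs z) ->
    (forall n, measurable_fun setT (fun w => h (F n w))) ->
    P.-integrable setT (EFin \o (fun w => h (f w))) ->
    (forall w, h (F n w) @[n --> \oo] --> h (f w)) ->
    \int[P]_w h (F n w) @[n --> \oo] --> \int[P]_w h (f w).
  move=> hc mF iF hF.
  have cv : (\int[P]_w (h (F n w))%:E)%E @[n --> \oo] --> (\int[P]_w (h (f w))%:E)%E.
    apply: (@dominated_cvg _ _ _ P _ _ _ _ (EFin \o cst M)) => //.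
    - by move=> n; apply/measurable_EFinP.
    - by move=> w _; apply: cvg_EFin; [exact: nearW|exact: hF].
    - apply: (@integrable_bounded _ _ _ _ _ _ `|M|) => //.
      exact: fin_num_fun_lty.
    - by move=> n w _; rewrite /= lee_fin (le_trans (hc _)).
  move: cv; rewrite -[X in _ --> X]fineK; last exact: integrable_fin_num.
  by move=> /fine_cvg.
have [i1 i2] := bmf_integrable bf.
split; rewrite /cE/=; apply: key => //.
- by move=> z; rewrite /cabs lerDl.
- by move=> n; have [] := bF n.
- by move=> w; have [] := Ff w.
- by move=> z; rewrite /cabs lerDr.
- by move=> n; have [] := bF n.
- by move=> w; have [] := Ff w.
Qed.

Lemma eq_cE f g : f =1 g -> cE f = cE g.
Proof. by move=> /funext ->. Qed.

End complex_expectation.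
Notation bmf := bounded_measurable.

(** * Equalities of expectations deduced from test events *)

Section complex_expectation_determination.
Context {R : realType} {dis : measure_display} {T : measurableType dis}.
Variable P : probability T R.
Implicit Types (f g : T -> R[i]) (A B : set T) (G : set (set T)).

Let indM A f := fun w => cind A w * f w : R[i].

Lemma cabs_indM A (z : R[i]) M w : cabs z <= M -> cabs (cind A w * z) <= M.
Proof.
move=> zM; rewrite /cind indicE; case: (_ \in _); first by rewrite mul1r.
by rewrite mul0r /cabs/= normr0 addr0; exact: le_trans (cabs_ge0 _) zM.
Qed.

(** The events on which the two expectations agree form a lambda-system: proper differences by
    linearity, increasing unions by dominated convergence. *)
Lemma cE_pi_lambda G f g : setI_closed G -> G setT -> G `<=` measurable ->
  bmf f -> bmf g -> (forall A, G A -> cE P (indM A f) = cE P (indM A g)) ->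
  forall A, <<s G >> A -> cE P (indM A f) = cE P (indM A g).
Proof.
move=> GI GT Gm bf bg Gfg.
pose H := [set A | measurable A /\ cE P (indM A f) = cE P (indM A g)].
suff GH : <<s G >> `<=` H by move=> A /GH[].
apply: (lambda_system_subset GI) => //; last by move=> A GA; split; [exact: Gm|exact: Gfg].
split=> //.
- by split; [exact: measurableT|exact: Gfg].
- move=> A B BA [mA Afg] [mB Bfg]; split; first exact: measurableD.
  have D h : bmf h -> cE P (indM (A `\` B) h) = cE P (indM A h) - cE P (indM B h).
    move=> bh; have bA := bmfM (bmf_ind mA) bh; have bB := bmfM (bmf_ind mB) bh.
    rewrite -[- cE P (indM B h)]mulN1r -cEZ// -cED//; last exact: bmfM (bmf_cst (-1)) bB.
    apply: eq_cE => w; rewrite /indM mulN1r -mulrBl; congr (_ * _).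
    have [Bw|Bw] := pselect (B w).
      rewrite (cindT Bw) (cindT (BA _ Bw)) subrr cindF//.
      by case.
    rewrite (cindF Bw) subr0; have [Aw|Aw] := pselect (A w).
      by rewrite !cindT.
    by rewrite !cindF//; case.
  by rewrite !D// Afg Bfg.
- move=> F ndF HF; split; first by apply: bigcupT_measurable => n; have [] := HF n.
  have C h : bmf h -> ccvg (fun n => cE P (indM (F n) h)) (cE P (indM (\bigcup_n F n) h)).
    move=> bh; have [_ _ [M hM]] := bh.
    apply: (@cE_cvg _ _ _ _ _ _ M).
    - by move=> n; apply: bmfM => //; apply: bmf_ind; have [] := HF n.
    - by move=> n w; exact: cabs_indM.
    - move=> w; apply: ccvgM; last exact: ccvg_cst.
      have [[n _ Fnw]|Fw] := pselect ((\bigcup_n F n) w).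
        apply: ccvg_near; exists n => // m nm /=; rewrite !cindT//.
          by exists n.
        by have /subsetPset := ndF _ _ nm; exact.
      by apply: eq_ccvg (ccvg_cst _) => n; rewrite !cindF// => Fnw; apply: Fw; exists n.
  apply: ccvg_unique (C _ bf) _; apply: eq_ccvg (C _ bg) => n.
  by have [_ ->] := HF n.
Qed.

(** The sum counts the positive integers up to x, so it is the integer part of x. Truncating at [m]
    in the auxiliary claim makes it provable by induction on the number of terms. *)
Lemma sum_threshold (x : R) n : 0 <= x <= n%:R ->
  x - 1 <= \sum_(k < n) (if k.+1%:R <= x then 1 else 0) <= x.
Proof.
move=> /andP[x0 xn].
suff H m : Num.min (x - 1) m%:R <= \sum_(k < m) (if k.+1%:R <= x then 1 else 0) <=
    Num.min x m%:R.
  have := H n; rewrite (min_idPl xn) (min_idPl (le_trans _ xn))//.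
  by rewrite lerBlDr lerDl.
elim: m => [|m]; first by rewrite big_ord0 ge_min lexx orbT le_min x0/=.
rewrite big_ord_recr/= !ge_min !le_min => /andP[IH1 /andP[IH2 IH3]].
move: IH1; rewrite -natr1.
case: ifPn => [mx|]; last rewrite -ltNge => mx; move=> /orP[]; move: IH2 IH3 mx;
  set S := \sum_(_ < _) _; move: S (m%:R) => S mR; lra.
Qed.

(* A G-measurable weight with values in [0, 1] is a uniform limit of averages
   of indicators of its upper level sets. *)
Lemma cE_weight G (W : T -> R) f g : G `<=` measurable ->
  (forall B : set R, measurable B -> G (W @^-1` B)) -> (forall w, 0 <= W w <= 1) ->
  bmf f -> bmf g -> (forall A, G A -> cE P (indM A f) = cE P (indM A g)) ->
  cE P (fun w => (W w)%:C * f w) = cE P (fun w => (W w)%:C * g w).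
Proof.
move=> Gm GW W01 bf bg Gfg.
pose L n k := W @^-1` [set x : R | k.+1%:R / n.+1%:R <= x].
have GL n k : G (L n k).
  apply: GW; rewrite [X in measurable X](_ : _ = `[k.+1%:R / n.+1%:R, +oo[%classic).
    exact: measurable_itv.
  by apply/seteqP; split => x /=; rewrite in_itv/= andbT.
(* [V n] is the integer part of (n+1) W divided by n+1, hence at most 1 / (n+1) below [W]. *)
pose V n w : R[i] := (n.+1%:R^-1 : R)%:C * \sum_(k < n.+1) cind (L n k) w.
have bL n (k : 'I_n.+1) h : bmf h -> bmf (indM (L n k) h).
  by move=> bh; apply: bmfM => //; apply: bmf_ind; apply: Gm; exact: GL.
have bV n : bmf (V n).
  apply: bmfM; first exact: bmf_cst.
  by apply: bmf_sum => k; apply: bmf_ind; apply: Gm; exact: GL.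
have VE n w : V n w = (n.+1%:R^-1 *
    \sum_(k < n.+1) (if k.+1%:R <= n.+1%:R * W w then 1 else 0))%:C.
  rewrite /V rmorphM rmorph_sum; congr (_ * _); apply: eq_bigr => k _.
  have -> : (k.+1%:R <= n.+1%:R * W w) = (k.+1%:R / n.+1%:R <= W w).
    by rewrite ler_pdivrMr// mulrC.
  by case: ifPn => h; [rewrite cindT|rewrite cindF//; exact/negP].
have VW n w : W w - n.+1%:R^-1 <= complex.Re (V n w) <= W w.
  rewrite VE/=; have /andP[W0 W1] := W01 w.
  have /sum_threshold : 0 <= n.+1%:R * W w <= n.+1%:R by rewrite mulr_ge0//= ler_piMr.
  set S := \sum_(_ < _) _ => /andP[h1 h2].
  rewrite -(ler_pM2l (ltr0Sn R n)) -[X in _ && X](ler_pM2l (ltr0Sn R n)).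
  by rewrite mulrBr !mulrA divff// mul1r h1.
have V1 n w : cabs (V n w) <= 1.
  have := VW n w; have /andP[W0 W1] := W01 w; rewrite VE/= cabs_real => /andP[_ h].
  rewrite ger0_norm ?(le_trans h)// mulr_ge0 ?invr_ge0// sumr_ge0// => k _.
  by case: ifP.
have C h : bmf h -> ccvg (fun n => cE P (fun w => V n w * h w))
    (cE P (fun w => (W w)%:C * h w)).
  move=> bh; have [_ _ [M hM]] := bh.
  apply: (@cE_cvg _ _ _ _ _ _ M).
  - by move=> n; exact: bmfM.
  - move=> n w; rewrite (le_trans (cabsM _ _))//.
    by rewrite -[leRHS]mul1r ler_pM ?cabs_ge0.
  - move=> w; apply: ccvgM; last exact: ccvg_cst.
    split=> /=; last first.
      by apply: eq_cvgn (cvg_cst _) => n; rewrite VE.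
    apply: (@squeeze_cvgr _ _ _ _ (fun n => W w - n.+1%:R^-1) (fun=> W w)).
    + by apply: nearW => n; exact: VW.
    + rewrite -[X in _ --> X]subr0; apply: cvgB; first exact: cvg_cst.
      exact: cvg_harmonic.
    + exact: cvg_cst.
have VhE n h : bmf h -> cE P (fun w => V n w * h w) =
    (n.+1%:R^-1 : R)%:C * \sum_(k < n.+1) cE P (indM (L n k) h).
  move=> bh; rewrite -cE_sum; last by move=> k; exact: bL.
  rewrite -cEZ; last by apply: bmf_sum => k; exact: bL.
  by apply: eq_cE => w; rewrite /V -mulrA mulr_suml.
apply: ccvg_unique (C _ bf) _; apply: eq_ccvg (C _ bg) => n.
rewrite !VhE//; congr (_ * _); apply: eq_bigr => k _.
by rewrite Gfg.
Qed.

(** The truncation of [f] to nu < n is a finite sum over values of [nu], and these truncations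
    converge boundedly to [f]. *)
Lemma cE_countable (nu : T -> nat) f g :
  (forall m, measurable (nu @^-1` [set m])) -> bmf f -> bmf g ->
  (forall m, cE P (indM (nu @^-1` [set m]) f) = cE P (indM (nu @^-1` [set m]) g)) ->
  cE P f = cE P g.
Proof.
move=> mnu bf bg fg.
have bI m h : bmf h -> bmf (indM (nu @^-1` [set m]) h).
  by move=> bh; apply: bmfM => //; exact: bmf_ind.
have sumE n h w : \sum_(m < n) indM (nu @^-1` [set (m : nat)]) h w =
    if (nu w < n)%N then h w else 0.
  rewrite -mulr_suml; case: ifPn => [wn|]; last first.
    rewrite -leqNgt => nw; rewrite big1 ?mul0r// => m _.
    rewrite cindF//= => wm; have := ltn_ord m; rewrite -wm ltnNge.
    by rewrite nw.
  rewrite (bigD1 (Ordinal wn))//= big1 ?addr0 ?cindT ?mul1r// => m.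
  rewrite -val_eqE/= => mw; rewrite cindF//= => wm.
  by rewrite wm eqxx in mw.
have C h : bmf h -> ccvg (fun n => \sum_(m < n) cE P (indM (nu @^-1` [set (m : nat)]) h)) (cE P h).
  move=> bh; have [_ _ [M hM]] := bh.
  apply: eq_ccvg (@cE_cvg _ _ _ P (fun n w => \sum_(m < n) indM (nu @^-1` [set (m : nat)]) h w) h M _ _ _).
  - by move=> n; rewrite cE_sum// => m; exact: bI.
  - by move=> n; apply: bmf_sum => m; exact: bI.
  - move=> n w; rewrite sumE; case: ifP => // _.
    by rewrite /cabs/= normr0 addr0; exact: le_trans (cabs_ge0 _) (hM w).
  - move=> w; apply: ccvg_near; exists (nu w).+1 => // n /= wn.
    by rewrite sumE wn.
apply: ccvg_unique (C _ bf) _; apply: eq_ccvg (C _ bg) => n.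
by apply: eq_bigr => m _; rewrite fg.
Qed.

End complex_expectation_determination.

(** * The Markov chain and its intensity *)

Lemma cvg_finsum (R : numFieldType) (V : normedModType R) (U I : Type)
    (F : set_system U) (FF : Filter F) (r : seq I) (f : I -> U -> V) (l : I -> V) :
  (forall i, f i x @[x --> F] --> l i) ->
  \sum_(i <- r) f i x @[x --> F] --> \sum_(i <- r) l i.
Proof.
move=> fl; elim: r => [|i r IH].
  by rewrite big_nil; under eq_fun do rewrite big_nil; exact: cvg_cst.
by rewrite big_cons; under eq_fun do rewrite big_cons; exact: cvgD.
Qed.

Section markov_chain.
Context {R : realType} {dis : measure_display} {T : measurableType dis}.
Variable P : probability T R.
Context {d : nat}.
Variables (Q : 'M[R]_d) (lambda : 'cV[R]_d) (X : R -> T -> 'cV[R]_d).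
Hypothesis lambda_ge0 : forall j, 0 <= lambda j 0.
Hypothesis chain : is_markov_chain P Q X.

Definition state_event (r : R) (i : 'I_d) : set T := X r @^-1` [set delta_mx i 0].

Local Notation ev := state_event.
Local Notation ind := (@cind R _ T).

Lemma cind_state r i w : 0 <= r -> ind (ev r i) w = (X r w i 0)%:C.
Proof.
move=> r0; have [j Xj] := chain_state chain w r0.
rewrite Xj mxE eqxx andbT; have [->|ij] := eqVneq i j; first by rewrite cindT.
rewrite cindF// /state_event/= Xj => /matrixP/(_ i 0).
by rewrite !mxE !eqxx (negbTE ij) => /eqP; rewrite eq_sym oner_eq0.
Qed.

Lemma cind_state_cond r i j w : X r w = delta_mx j 0 -> ind (ev r i) w = (i == j)%:R.
Proof.
move=> Xj; have [->|ij] := eqVneq i j; first by rewrite cindT.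
rewrite cindF// /state_event/= Xj => /matrixP/(_ i 0).
by rewrite !mxE !eqxx (negbTE ij) => /eqP; rewrite eq_sym oner_eq0.
Qed.

Lemma state_event_upto r s i : 0 <= r -> r <= s -> sigma_upto X s (ev r i).
Proof.
move=> r0 rs; apply: sub_sigma_algebra; exists r, (delta_mx i 0); split=> //=.
by rewrite in_itv/= r0.
Qed.

Lemma sigma_upto_mono s t : s <= t -> sigma_upto X s `<=` sigma_upto X t.
Proof.
move=> st; apply: sub_sigma_algebra2 => A [r [y [/= rs ->]]]; exists r, y; split => //=.
by move: rs; rewrite !in_itv/= => /andP[-> /le_trans]; exact.
Qed.

Lemma sigma_upto_all s : sigma_upto X s `<=` sigma_all X.
Proof.
apply: sub_sigma_algebra2 => A [r [y [/= rs ->]]]; exists r, y; split => //=.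
by move: rs; rewrite !in_itv/= => /andP[->].
Qed.

Lemma sigma_all_measurable : sigma_all X `<=` measurable.
Proof.
apply: smallest_sub; first exact: sigma_algebra_measurable.
exact: chain_measurable chain.
Qed.

Lemma sigma_upto_measurable s : sigma_upto X s `<=` measurable.
Proof. by move=> A /sigma_upto_all/sigma_all_measurable. Qed.

Lemma sigma_uptoI s A B : sigma_upto X s A -> sigma_upto X s B -> sigma_upto X s (A `&` B).
Proof. exact: (@measurableI _ (g_sigma_algebraType (history X `[0, s]))). Qed.

Lemma sigma_allI A B : sigma_all X A -> sigma_all X B -> sigma_all X (A `&` B).
Proof. exact: (@measurableI _ (g_sigma_algebraType (history X `[0, +oo[))). Qed.

Lemma measurable_state_event r i : 0 <= r -> measurable (ev r i).
Proof. by move=> r0; apply: (@sigma_upto_measurable r); exact: state_event_upto. Qed.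

Lemma bmf_state r i : 0 <= r -> bmf (ind (ev r i)).
Proof. by move=> r0; apply: bmf_ind; exact: measurable_state_event. Qed.

Definition intensity (w : T) (r : R) : R := (lambda^T *m X r w) 0 0.

Lemma intensity_cond w r j : X r w = delta_mx j 0 -> intensity w r = lambda j 0.
Proof.
move=> Xj; rewrite /intensity Xj mxE (bigD1 j)//= big1 ?addr0.
  by rewrite !mxE !eqxx mulr1.
by move=> i ij; rewrite !mxE (negbTE ij) mulr0.
Qed.

Lemma intensity_bound w r : 0 <= r -> 0 <= intensity w r <= \sum_j lambda j 0.
Proof.
move=> r0; have [j Xj] := chain_state chain w r0.
by rewrite (intensity_cond Xj) lambda_ge0/= (bigD1 j)//= lerDl sumr_ge0.
Qed.

Lemma intensity_right w r : 0 <= r -> intensity w y @[y --> r^'+] --> intensity w r.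
Proof.
move=> r0; have [right _] := chain_cadlag chain w.
rewrite /intensity mxE; under eq_cvg do rewrite mxE.
apply: cvg_finsum => j; apply: cvgM; first exact: cvg_cst.
exact: (cvg_comp (fun y => X y w) (fun M : 'cV[R]_d => M j 0) (right r r0)
  (@coord_continuous R _ _ j 0 (X r w))).
Qed.

Local Notation Lam := (cumulated_intensity lambda X).

Lemma cumulated_intensity_ge0 a b w : 0 <= a -> 0 <= Lam a b w.
Proof.
move=> a0; apply: Rintegral_ge0 => r; rewrite /= in_itv/= => /andP[ar _].
by have /andP[] := intensity_bound w (le_trans a0 ar).
Qed.

Definition intensity_sum (a b : R) (n : nat) (w : T) : R :=
  \sum_(k < n.+1) (b - a) / n.+1%:R * intensity w (a + k.+1%:R * ((b - a) / n.+1%:R)).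

Lemma intensity_sum_cvg a b w : 0 <= a -> a <= b ->
  intensity_sum a b n w @[n --> \oo] --> Lam a b w.
Proof.
move=> a0; rewrite le_eqVlt => /predU1P[<-|ab].
  rewrite /cumulated_intensity set_itv1 Rintegral_set1.
  apply: eq_cvgn (cvg_cst _) => n; rewrite /intensity_sum big1// => k _.
  by rewrite subrr !mul0r.
apply: (@riemann_sum_cvg _ _ _ _ (\sum_j lambda j 0)) => // r ar.
- by apply: intensity_right; exact: le_trans ar.
- by apply: intensity_bound; exact: le_trans ar.
Qed.

Lemma intensity_sum_ge0 a b n w : 0 <= a -> a <= b -> 0 <= intensity_sum a b n w.
Proof.
move=> a0 ab; apply: sumr_ge0 => k _.
have h0 : 0 <= (b - a) / n.+1%:R by rewrite divr_ge0 ?subr_ge0.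
have /andP[i0 _] := @intensity_bound w (a + k.+1%:R * ((b - a) / n.+1%:R))
  (addr_ge0 a0 (mulr_ge0 (ler0n _ _) h0)).
exact: mulr_ge0.
Qed.

(* Measurability for a sub-sigma-algebra G is stated as measurability on the
   type g_sigma_algebraType, whose measurable sets are those of <<s G>>. *)
Lemma measurable_intensity_sum a b s n : 0 <= a -> a <= b -> b <= s ->
  measurable_fun (setT : set (g_sigma_algebraType (history X `[0, s]))) (intensity_sum a b n).
Proof.
move=> a0 ab bs; apply: measurable_sum => k; apply: measurable_funM => //.
set r := a + _.
have h0 : 0 <= (b - a) / n.+1%:R by rewrite divr_ge0 ?subr_ge0.
have r0 : 0 <= r by rewrite addr_ge0// mulr_ge0.
have rs : r <= s.
  apply: le_trans bs; rewrite /r -lerBrDl mulrCA ler_piMr ?subr_ge0//.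
  by rewrite ler_pdivrMr// mul1r ler_nat.
rewrite (_ : (fun w => intensity w r) = fun w => \sum_j lambda^T 0 j * X r w j 0); last first.
  by apply/funext => w; rewrite /intensity mxE.
apply: measurable_sum => j; apply: measurable_funM => //.
have -> : (fun w => X r w j 0) = \1_(ev r j).
  apply/funext => w; have := cind_state j w r0.
  by rewrite /cind => /(congr1 (@complex.Re R)).
by apply: measurable_indic; exact: state_event_upto.
Qed.

Lemma measurable_cumulated_intensity a b s : 0 <= a -> a <= b -> b <= s ->
  measurable_fun (setT : set (g_sigma_algebraType (history X `[0, s]))) (Lam a b).
Proof.
move=> a0 ab bs.
apply: (@measurable_fun_cvg _ (g_sigma_algebraType (history X `[0, s])) _ _ (intensity_sum a b)).
  by move=> n; exact: measurable_intensity_sum.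
by move=> w _; exact: intensity_sum_cvg.
Qed.

End markov_chain.

(** * The Feynman-Kac formula *)

Section feynman_kac.
Context {R : realType} {dis : measure_display} {T : measurableType dis}.
Variable P : probability T R.
Context {d : nat}.
Variables (Q : 'M[R]_d) (lambda : 'cV[R]_d) (X : R -> T -> 'cV[R]_d) (u : R).
Hypothesis lambda_ge0 : forall j, 0 <= lambda j 0.
Hypothesis chain : is_markov_chain P Q X.

Local Notation ev := (state_event X).
Local Notation ind := (@cind R _ T).
Local Notation Lam := (cumulated_intensity lambda X).

Lemma cE_ind_real (A : set T) (f : T -> R) :
  cE P (fun w => ind A w * (f w)%:C) = (fine (\int[P]_(w in A) (f w)%:E))%:C.
Proof.
have E w : ind A w * (f w)%:C = ((f \_ A) w)%:C.
  rewrite patchE /cind indicE; case: (_ \in _); first by rewrite mul1r.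
  by rewrite mul0r.
rewrite (eq_cE _ E); apply: complexP => /=.
  by rewrite -[LHS]/(\int[P]_w ((f \_ A) w)) -Rintegral_mkcond.
by rewrite /Rintegral integral0.
Qed.

Definition poisson_cf (x : R) : R[i] := cexp (x%:C * (expi u - 1)).

Lemma poisson_cfE x : poisson_cf x =
  (expR (x * (cos u - 1)))%:C * expi (x * sin u).
Proof.
rewrite /poisson_cf /cexp; congr ((expR _)%:C * expi _).
  by rewrite cReM/=; ring.
by rewrite cImM/=; ring.
Qed.

Lemma poisson_cf_sum n (f : 'I_n -> R) :
  poisson_cf (\sum_i f i) = \prod_i poisson_cf (f i).
Proof.
rewrite /poisson_cf; apply: (big_morph (fun x : R => cexp (x%:C * (expi u - 1)))).
  by move=> x y; rewrite rmorphD mulrDl cexpD.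
by rewrite mul0r cexp0.
Qed.

(** The modulus is exp(x (cos u - 1)), at most 1 for x >= 0; the 2 is the bound of [cabs] on the
    unit circle. *)
Lemma cabs_poisson_cf x : 0 <= x -> cabs (poisson_cf x) <= 2.
Proof.
move=> x0; rewrite poisson_cfE (le_trans (cabsM _ _))// cabs_real ger0_norm ?expR_ge0//.
rewrite -[leRHS]mul1r ler_pM ?expR_ge0 ?cabs_ge0 ?cabs_expi//.
by rewrite -expR0 ler_expR mulr_ge0_le0// subr_le0 cos_le1.
Qed.

Lemma bmf_poisson_cf (f : T -> R) : measurable_fun setT f -> (forall w, 0 <= f w) ->
  bmf (fun w => poisson_cf (f w)).
Proof.
move=> mf f0; have cm (c : R) : measurable_fun setT (fun w => f w * c).
  by apply: measurable_funM.
split.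
- under eq_fun do rewrite poisson_cfE cReM /= mul0r subr0.
  apply: measurable_funM; first by apply: measurableT_comp => //; exact: cm.
  apply: measurableT_comp; last exact: cm.
  by apply: continuous_measurable_fun; exact: continuous_cos.
- under eq_fun do rewrite poisson_cfE cImM /= mul0r addr0.
  apply: measurable_funM; first by apply: measurableT_comp => //; exact: cm.
  apply: measurableT_comp; last exact: cm.
  by apply: continuous_measurable_fun; exact: continuous_sin.
- by exists 2 => w; apply: cabs_poisson_cf.
Qed.

Lemma poisson_cf_cvg (x : nat -> R) (y : R) : x n @[n --> \oo] --> y ->
  ccvg (fun n => poisson_cf (x n)) (poisson_cf y).
Proof.
move=> xy; rewrite poisson_cfE.
have xM c : x n * c @[n --> \oo] --> y * c by apply: cvgM => //; exact: cvg_cst.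
apply: eq_ccvg (ccvgM (@ccvg_real _ (fun n => expR (x n * (cos u - 1))) _ _)
  (_ : ccvg (fun n => expi (x n * sin u)) _)) => [n||].
- by rewrite poisson_cfE.
- by apply: continuous_cvg; [exact: continuous_expR|exact: xM].
- split.
    by apply: (continuous_cvg _ (@continuous_cos R _)); exact: xM.
  by apply: (continuous_cvg _ (@continuous_sin R _)); exact: xM.
Qed.

Section transition.
Variable p : R -> 'M[R]_d.
Hypothesis pQ : is_transition_function Q p.
Hypothesis markov : forall s t, 0 <= s -> s <= t -> forall i : 'I_d,
  is_condexp P (sigma_upto X s)
    (fun w => X t w i 0) (fun w => (p (t - s) *m X s w) i 0).

Lemma markov_step s h A i : 0 <= s -> 0 <= h -> sigma_upto X s A ->
  cE P (fun w => ind A w * ind (ev (s + h) i) w) =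
  \sum_m (p h i m)%:C * cE P (fun w => ind A w * ind (ev s m) w).
Proof.
move=> s0 h0 GA; have sh : s <= s + h by rewrite lerDl.
have sh0 : 0 <= s + h by rewrite addr_ge0.
have mA := sigma_upto_measurable chain GA.
transitivity (cE P (fun w => ind A w * (X (s + h) w i 0)%:C)).
  by apply: eq_cE => w; rewrite (cind_state chain).
rewrite cE_ind_real -(condexp_integral (markov s0 sh i) GA) -cE_ind_real.
rewrite addrAC subrr add0r.
have bA m : bmf (fun w => ind A w * ind (ev s m) w).
  by apply: bmfM; [exact: bmf_ind|exact: (bmf_state chain)].
under [RHS]eq_bigr => m _ do rewrite -cEZ//.
rewrite -cE_sum; last by move=> m; apply: bmfM => //; exact: bmf_cst.
apply: eq_cE => w; rewrite mxE rmorph_sum mulr_sumr; apply: eq_bigr => m _.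
by rewrite (cind_state chain)// rmorphM mulrCA.
Qed.

(** The weight sits on the row, that is, on the arrival state, because the intensity is evaluated at
    the right end of each step. *)
Definition weighted_transition (h : R) : 'M[R[i]]_d :=
  \matrix_(i, j) (poisson_cf (h * lambda i 0) * (p h i j)%:C).

(** The first step is peeled off by splitting on the state at s + h, and the induction hypothesis is
    applied from time s + h to [A] intersected with that state event. Hence [s] and [A] vary in the
    induction. *)
Lemma feynman_kac_discrete n : forall s h A j, 0 <= s -> 0 <= h -> sigma_upto X s A ->
  cE P (fun w => ind A w * (ind (ev (s + n%:R * h) j) w *
    \prod_(k < n) poisson_cf (h * intensity lambda X w (s + k.+1%:R * h)))) =
  \sum_i (weighted_transition h ^+ n) j i * cE P (fun w => ind A w * ind (ev s i) w).
Proof.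
elim: n => [|n IH] s h A j s0 h0 GA.
  rewrite expr0 (bigD1 j)//= big1 ?addr0 => [|i ij].
    rewrite mxE eqxx mul1r; apply: eq_cE => w.
    by rewrite mul0r addr0 big_ord0 mulr1.
  by rewrite mxE eq_sym (negbTE ij) mul0r.
have sh0 : 0 <= s + h by rewrite addr_ge0.
have ssh : s <= s + h by rewrite lerDl.
have mA := sigma_upto_measurable chain GA.
have GAi i : sigma_upto X (s + h) (A `&` ev (s + h) i).
  by apply: sigma_uptoI; [exact: sigma_upto_mono ssh _ GA|exact: state_event_upto].
pose F w := ind (ev (s + h + n%:R * h) j) w *
    \prod_(k < n) poisson_cf (h * intensity lambda X w (s + h + k.+1%:R * h)).
have shn k : 0 <= s + h + k%:R * h by rewrite addr_ge0// mulr_ge0.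
have bcf r : 0 <= r -> bmf (fun w => poisson_cf (h * intensity lambda X w r)).
  move=> r0.
  have -> : (fun w => poisson_cf (h * intensity lambda X w r)) =
      fun w => \sum_i poisson_cf (h * lambda i 0) * ind (ev r i) w.
    apply/funext => w; have [i Xi] := chain_state chain w r0.
    rewrite (intensity_cond _ Xi) (bigD1 i)//= big1 ?addr0.
      by rewrite (cind_state_cond _ Xi) eqxx mulr1.
    by move=> k ki; rewrite (cind_state_cond _ Xi) (negbTE ki) mulr0.
  apply: bmf_sum => i; apply: bmfM; [exact: bmf_cst|exact: (bmf_state chain)].
have bF : bmf F.
  apply: bmfM; first exact: (bmf_state chain).
  by apply: bmf_prod => k; exact: bcf.
have bAF i : bmf (fun w => ind (A `&` ev (s + h) i) w * F w).
  by apply: bmfM => //; apply: bmf_ind; exact: (sigma_upto_measurable chain (GAi i)).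
transitivity (\sum_i poisson_cf (h * lambda i 0) *
    cE P (fun w => ind (A `&` ev (s + h) i) w * F w)).
  under [RHS]eq_bigr => i _ do rewrite -cEZ//.
  rewrite -cE_sum; last by move=> i; apply: bmfM => //; exact: bmf_cst.
  apply: eq_cE => w; have [i Xi] := chain_state chain w sh0.
  rewrite [RHS](bigD1 i)//= [X in _ = _ + X]big1 ?addr0 => [|k ki]; last first.
    by rewrite /= cindI (cind_state_cond _ Xi) (negbTE ki) mulr0 mul0r mulr0.
  rewrite cindI (cind_state_cond _ Xi) eqxx mulr1 /F big_ord_recl/= mul1r.
  rewrite (intensity_cond _ Xi) -natr1 mulrDl mul1r [n%:R * h + h]addrC addrA.
  rewrite [RHS]mulrCA; congr (_ * _); rewrite mulrCA; congr (_ * (_ * _)).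
  apply: eq_bigr => k _; congr (poisson_cf (_ * intensity _ _ _ _)).
  by rewrite /bump/= add1n -natr1 mulrDl mul1r; ring.
transitivity (\sum_i (weighted_transition h ^+ n) j i * (poisson_cf (h * lambda i 0) *
    cE P (fun w => ind A w * ind (ev (s + h) i) w))).
  (* The event already fixes the state at s + h, so only the term [i] survives in the sum over
     states given by the induction hypothesis. *)
  apply: eq_bigr => i _; rewrite (IH _ _ _ _ sh0 h0 (GAi i)) (bigD1 i)//= big1 ?addr0.
    rewrite mulrCA; congr (_ * (_ * _)); apply: eq_cE => w.
    rewrite cindI -mulrA; congr (_ * _).
    by rewrite -cindI setIid.
  move=> k ki; rewrite [X in _ * X](_ : _ = 0) ?mulr0// -(@cE0 _ _ _ P).
  apply: eq_cE => w; have [l Xl] := chain_state chain w sh0.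
  rewrite cindI !(cind_state_cond _ Xl).
  by have [<-|il] := eqVneq i l; rewrite ?(negbTE ki) ?mulr0 ?mul0r.
under eq_bigr => i _ do rewrite (markov_step _ s0 h0 GA) !mulr_sumr.
rewrite exchange_big/=; apply: eq_bigr => m _.
rewrite exprSr [in RHS]mxE mulr_suml; apply: eq_bigr => i _.
by rewrite !mxE !mulrA.
Qed.

End transition.
End feynman_kac.

(** * First-order expansion of the weighted transition matrix *)

Section weighted_limit.
Context {R : realType} {d : nat}.
Variables (Q : 'M[R]_d) (lambda : 'cV[R]_d) (u : R) (p : R -> 'M[R]_d).
Hypothesis pQ : is_transition_function Q p.

Definition mmpp_generator : 'M[R[i]]_d :=
  (expi u - 1) *: complex_mx (diag_mx lambda^T) + complex_mx Q.

Lemma transition_quotient (t : R) i j : 0 <= t ->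
  n.+1%:R * (p (t / n.+1%:R) - 1%:M) i j @[n --> \oo] --> t * Q i j.
Proof.
rewrite le_eqVlt => /predU1P[<-|t0].
  rewrite mul0r; apply: eq_cvgn (cvg_cst _) => n.
  by rewrite mul0r (transition0 pQ) subrr mxE mulr0.
have gen : (fun h : R => (h^-1 *: (p h - 1%:M)) i j) @ 0^'+ --> Q i j.
  exact: (cvg_comp _ (fun M : 'M[R]_d => M i j) (transition_generator pQ)
    (@coord_continuous R _ _ i j Q)).
have /cvg_at_rightP/(_ (fun n => t / n.+1%:R)) := gen.
move=> H; apply: eq_cvgn (cvgM (cvg_cst t) (H _)) => [n|].
  by rewrite /= mxE invfM invrK !mulrA divff ?mul1r// gt_eqF.
split=> [n|]; first by rewrite divr_gt0.
by rewrite -(mulr0 t); apply: cvgM; [exact: cvg_cst|exact: cvg_harmonic].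
Qed.

(** With g the weight of row i, g p - 1 = (g - 1) p + (p - 1). After multiplication by n+1, the
    first term tends to t lambda_i (e^(iu) - 1) on the diagonal, since p tends to the identity, and
    the second to t Q. *)
Lemma weighted_transition_quotient (t : R) i j : 0 <= t ->
  ccvg (fun n => (n.+1%:R : R)%:C * (weighted_transition lambda u p (t / n.+1%:R) -
      (1 + (n.+1%:R : R)^-1%:C *: (t%:C *: mmpp_generator))) i j) 0.
Proof.
move=> t0.
have nz : ccvg (fun n => (n.+1%:R^-1 : R)%:C) 0.
  by apply: (@ccvg_real _ _ 0); exact: cvg_harmonic.
have pq := ccvg_real (@transition_quotient t i j t0).
have p1 : ccvg (fun n => ((p (t / n.+1%:R) i j))%:C) ((i == j)%:R)%:C.
  rewrite -[X in ccvg _ X]addr0 -(mul0r (t * Q i j)%:C).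
  apply: eq_ccvg (ccvgD (ccvg_cst _) (ccvgM nz pq)) => n.
  rewrite -rmorphM mulrA mulVf// mul1r !mxE rmorphB/=.
  by rewrite addrC subrK.
have G := cexp_quotient ((t * lambda i 0)%:C * (expi u - 1)).
rewrite (_ : 0 = (t * lambda i 0)%:C * (expi u - 1) * ((i == j)%:R)%:C + (t * Q i j)%:C
    - t%:C * mmpp_generator i j); last first.
  rewrite /mmpp_generator !mxE eq_sym.
  by case: (i == j); rewrite ?mulr1n ?mulr0n ?rmorphM/=; ring.
apply: eq_ccvg (ccvgB (ccvgD (ccvgM G p1) pq) (ccvg_cst _)) => n.
have -> : cexp ((n.+1%:R^-1 : R)%:C * ((t * lambda i 0)%:C * (expi u - 1))) =
    poisson_cf u (t / n.+1%:R * lambda i 0).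
  by rewrite /poisson_cf; congr cexp; rewrite !rmorphM/=; ring.
rewrite !mxE; set g := poisson_cf _ _.
have n0 : (n.+1%:R : R)%:C * (n.+1%:R^-1 : R)%:C = 1.
  by rewrite -rmorphM divff// rmorph1.
rewrite rmorphM rmorphB/= -[in RHS](rmorph_nat (@real_complex R)).
rewrite [RHS]mulrBr [X in _ = _ - X]mulrDr [X in _ = _ - (_ + X)]mulrA n0.
by ring.
Qed.

Lemma weighted_transition_limit (t : R) i j : 0 <= t ->
  ccvg (fun n => (weighted_transition lambda u p (t / n.+1%:R) ^+ n.+1) i j)
       (expmx (t%:C *: mmpp_generator) i j).
Proof.
move=> t0.
pose E n := weighted_transition lambda u p (t / n.+1%:R) -
      (1 + (n.+1%:R : R)^-1%:C *: (t%:C *: mmpp_generator)).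
(* The sum over all entries bounds every row sum, and being finite it yields the required limit from
   the entrywise one. *)
apply: (@expmx_limit _ _ _ _ (fun n => \sum_k \sum_l cabs (E n k l))) => [n|].
  split=> [|k].
    by apply: sumr_ge0 => k _; apply: sumr_ge0 => l _; exact: cabs_ge0.
  rewrite [leRHS](bigD1 k)//= lerDl sumr_ge0// => m _.
  by apply: sumr_ge0 => l _; exact: cabs_ge0.
rewrite [X in _ --> X](_ : 0 = \sum_(k < d) \sum_(l < d) (0 : R)); last first.
  by rewrite big1// => k _; rewrite big1.
apply: (@eq_cvgn _ (fun n => \sum_k \sum_l cabs ((n.+1%:R : R)%:C * E n k l))).
  move=> n; rewrite mulr_sumr; apply: eq_bigr => k _.
  rewrite mulr_sumr; apply: eq_bigr => l _.
  by rewrite /cabs !cReM !cImM /= !mul0r subr0 addr0 !normrM ger0_norm// mulrDr.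
apply: cvg_finsum => k; apply: cvg_finsum => l.
by apply/ccvg0_cabs; exact: weighted_transition_quotient.
Qed.

End weighted_limit.

Section feynman_kac_limit.
Context {R : realType} {dis : measure_display} {T : measurableType dis}.
Variable P : probability T R.
Context {d : nat}.
Variables (Q : 'M[R]_d) (lambda : 'cV[R]_d) (X : R -> T -> 'cV[R]_d) (u : R).
Hypothesis lambda_ge0 : forall j, 0 <= lambda j 0.
Hypothesis chain : is_markov_chain P Q X.

Local Notation ev := (state_event X).
Local Notation ind := (@cind R _ T).
Local Notation Lam := (cumulated_intensity lambda X).

Lemma measurable_upto (s : R) (f : T -> R) :
  measurable_fun (setT : set (g_sigma_algebraType (history X `[0, s]))) f ->
  measurable_fun setT f.
Proof.
move=> mf _ B mB; apply: (@sigma_upto_measurable _ _ _ P _ _ _ chain s).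
exact: (mf measurableT B mB).
Qed.

Lemma bmf_poisson_cf_cumulated a b : 0 <= a -> a <= b ->
  bmf (fun w => poisson_cf u (Lam a b w)).
Proof.
move=> a0 ab; apply: bmf_poisson_cf => [|w].
  apply: (@measurable_upto b).
  exact: (measurable_cumulated_intensity lambda_ge0 chain a0 ab (lexx b)).
exact: (cumulated_intensity_ge0 lambda_ge0 chain).
Qed.

(** Limit of the discrete formula with step (t - s) / (n+1): dominated convergence with the constant
    2 on the left, [weighted_transition_limit] on the right. *)
Lemma feynman_kac s t A j : 0 <= s -> s <= t -> sigma_upto X s A ->
  cE P (fun w => ind A w * (ind (ev t j) w * poisson_cf u (Lam s t w))) =
  cE P (fun w => ind A w *
    \sum_i expmx ((t - s)%:C *: mmpp_generator Q lambda u) j i * ind (ev s i) w).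
Proof.
move=> s0 st GA; have t0 := le_trans s0 st.
have [p pQ markov] := chain_markov chain.
have mA := sigma_upto_measurable chain GA.
have bA i : bmf (fun w => ind A w * ind (ev s i) w).
  by apply: bmfM; [exact: bmf_ind|exact: (bmf_state chain)].
have h0 n : 0 <= (t - s) / n.+1%:R by rewrite divr_ge0 ?subr_ge0.
transitivity (\sum_i expmx ((t - s)%:C *: mmpp_generator Q lambda u) j i *
    cE P (fun w => ind A w * ind (ev s i) w)); last first.
  under eq_bigr => i _ do rewrite -cEZ//.
  rewrite -cE_sum; last by move=> i; apply: bmfM => //; exact: bmf_cst.
  by apply: eq_cE => w; rewrite mulr_sumr; apply: eq_bigr => i _; rewrite mulrCA.
have lim1 : ccvg (fun n => cE P (fun w => ind A w * (ind (ev t j) w *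
      poisson_cf u (intensity_sum lambda X s t n w))))
    (cE P (fun w => ind A w * (ind (ev t j) w * poisson_cf u (Lam s t w)))).
  apply: (@cE_cvg _ _ _ _ _ _ 2).
  - move=> n; apply: bmfM; first exact: bmf_ind.
    apply: bmfM; first exact: (bmf_state chain).
    apply: bmf_poisson_cf => [|w].
      apply: (@measurable_upto t).
      exact: (measurable_intensity_sum lambda chain n s0 st (lexx t)).
    exact: (intensity_sum_ge0 lambda_ge0 chain).
  - move=> n w; apply: cabs_indM; apply: cabs_indM; apply: cabs_poisson_cf.
    exact: (intensity_sum_ge0 lambda_ge0 chain).
  - move=> w; apply: ccvgM; first exact: ccvg_cst.
    apply: ccvgM; first exact: ccvg_cst.
    by apply: poisson_cf_cvg; exact: (intensity_sum_cvg lambda_ge0 chain).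
apply: ccvg_unique lim1 _.
apply: eq_ccvg (ccvg_sum (index_enum 'I_d) (fun i => ccvgM
  (weighted_transition_limit lambda u pQ j i (_ : 0 <= t - s)) (ccvg_cst _))) => [n|]; last first.
  by rewrite subr_ge0.
rewrite -(feynman_kac_discrete lambda u chain markov n.+1 j s0 (h0 n) GA).
apply: eq_cE => w; congr (_ * _).
rewrite (_ : s + n.+1%:R * ((t - s) / n.+1%:R) = t); last first.
  by rewrite mulrCA divff// mulr1 subrKC.
by rewrite /intensity_sum poisson_cf_sum.
Qed.

End feynman_kac_limit.

(** * Prescribed increments of the counting process *)

Section poisson_cylinders.
Context {R : realType} {dis : measure_display} {T : measurableType dis}.
Variable P : probability T R.
Context {d : nat}.
Variables (Q : 'M[R]_d) (lambda : 'cV[R]_d) (X : R -> T -> 'cV[R]_d)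
  (N : R -> T -> nat) (u : R).
Hypothesis lambda_ge0 : forall j, 0 <= lambda j 0.
Hypothesis mmpp : is_mmpp P Q lambda X N.

Local Notation ev := (state_event X).
Local Notation ind := (@cind R _ T).
Local Notation Lam := (cumulated_intensity lambda X).
Local Notation z := (expi u).

Let chain := mmpp_chain mmpp.

Lemma measurable_poisson_weight d' (T' : measurableType d') (f : T' -> R) k :
  measurable_fun setT f -> measurable_fun setT (fun w => poisson_weight (f w) k).
Proof.
move=> mf; rewrite /poisson_weight; apply: measurable_funM.
  by apply: measurable_funM => //; exact: measurable_funX.
by apply: measurableT_comp => //; exact: measurable_funN.
Qed.

Definition increments n (tau : nat -> R) (k : nat -> nat) : set T :=
  [set w | forall i : nat, (i < n)%N -> N (tau i.+1) w = (N (tau i) w + k i)%N].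

Definition weights n (tau : nat -> R) (k : nat -> nat) (w : T) : R :=
  \prod_(i < n) poisson_weight (Lam (tau i) (tau i.+1) w) (k i).

Lemma measurable_count r m : 0 <= r -> measurable (N r @^-1` [set m]).
Proof.
move=> r0; apply: (mmpp_measurable mmpp); exists r, m; split => //=.
by rewrite in_itv/= r0.
Qed.

Lemma count_le a b w : 0 <= a -> a <= b -> (N a w <= N b w)%N.
Proof. exact: (@counting_path_le _ (fun r => N r w)) (mmpp_counting mmpp w). Qed.

Lemma bmf_count (nu : T -> nat) (g : nat -> R[i]) (M : R) :
  (forall m, measurable (nu @^-1` [set m])) -> (forall m, cabs (g m) <= M) ->
  bmf (fun w => g (nu w)).
Proof.
move=> mnu gM.
have mh (h : nat -> R) : measurable_fun setT (fun w => h (nu w)).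
  move=> _ B mB; rewrite setTI.
  rewrite (_ : _ @^-1` B = \bigcup_(m in [set m | B (h m)]) nu @^-1` [set m]).
    by apply: bigcup_measurable => m _; exact: mnu.
  apply/seteqP; split => [w Bw|w [m Bm /= wm]]; first by exists (nu w).
  by rewrite /= wm.
by split; [exact: (mh (fun m => complex.Re (g m)))
  |exact: (mh (fun m => complex.Im (g m)))|exists M].
Qed.

Lemma measurable_count_diff a b m : 0 <= a -> 0 <= b ->
  measurable ((fun w => N b w - N a w)%N @^-1` [set m]).
Proof.
move=> a0 b0.
rewrite (_ : _ @^-1` _ = \bigcup_i \bigcup_(k in [set k | (k - i)%N = m])
    (N a @^-1` [set i] `&` N b @^-1` [set k])).
  apply: bigcup_measurable => i _; apply: bigcup_measurable => k _.
  by apply: measurableI; exact: measurable_count.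
apply/seteqP; split => [w /= wm|w [i _ [k /= km [-> ->]]]] //.
by exists (N a w) => //; exists (N b w).
Qed.

Lemma cabs_expiX m : cabs (z ^+ m) <= 2.
Proof. by rewrite -expi_natr; exact: cabs_expi. Qed.

Section grid.
Variables (tau : nat -> R).
Hypothesis tau0 : 0 <= tau 0%N.
Hypothesis tauS : forall i, tau i <= tau i.+1.

Lemma tau_ge0 i : 0 <= tau i.
Proof. by elim: i => [|i IH] //; exact: le_trans (tauS i). Qed.

Lemma tau_mono i j : (i <= j)%N -> tau i <= tau j.
Proof.
move=> /subnKC <-; elim: (j - i)%N => [|m IH]; first by rewrite addn0.
by rewrite addnS; exact: le_trans (tauS _).
Qed.

(** The indicator of this event is the integrand in [conditionally_poisson], and integrability
    includes measurability. *)
Lemma measurable_increments n k : measurable (increments n tau k).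
Proof.
apply/(measurable_indicP R); have := condexp_integrand (mmpp_poisson mmpp n k tau0 tauS).
by move=> /measurable_int/measurable_EFinP.
Qed.

Lemma cE_increments n k (B : set T) : sigma_all X B ->
  cE P (fun w => ind B w * ind (increments n tau k) w) =
  cE P (fun w => ind B w * (weights n tau k w)%:C).
Proof.
move=> GB; have := condexp_integral (mmpp_poisson mmpp n k tau0 tauS) GB.
by move=> E; rewrite /cind !cE_ind_real E.
Qed.

Lemma weights_bound n k w : 0 <= weights n tau k w <= 1.
Proof.
have w01 i : 0 <= poisson_weight (Lam (tau i) (tau i.+1) w) (k i) <= 1.
  have L0 := cumulated_intensity_ge0 lambda_ge0 chain (tau i.+1) w (tau_ge0 i).
  by rewrite poisson_weight_ge0// poisson_weight_le1.
by apply/andP; split; [apply: prodr_ge0|apply: prodr_ile1] => i _; have /andP[] := w01 i.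
Qed.

Lemma measurable_weights n k s : tau n <= s ->
  measurable_fun (setT : set (g_sigma_algebraType (history X `[0, s]))) (weights n tau k).
Proof.
move=> ns; apply: measurable_prod => i _; apply: measurable_poisson_weight.
apply: (measurable_cumulated_intensity lambda_ge0 chain) => //; first exact: tau_ge0.
exact: le_trans (tau_mono (ltn_ord i)) ns.
Qed.

Lemma bmf_weights n k : bmf (fun w => (weights n tau k w)%:C).
Proof.
apply: (@bmf_real _ _ _ _ 1).
  exact: (measurable_upto chain (@measurable_weights n k (tau n) (lexx _))).
by move=> w; have /andP[h0 h1] := weights_bound n k w; rewrite ger0_norm.
Qed.

(** The last increment is summed over its values j: on the left z^j multiplies the event that it
    equals j, on the right the Poisson weight of j, whose sum is the generating function. The finite
    truncations agree by [cE_increments], and both sides converge boundedly. *)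
Lemma cE_increments_cf n k (B : set T) : sigma_all X B ->
  cE P (fun w => ind B w * (ind (increments n tau k) w *
    z ^+ (N (tau n.+1) w - N (tau n) w))) =
  cE P (fun w => ind B w * ((weights n tau k w)%:C *
    poisson_cf u (Lam (tau n) (tau n.+1) w))).
Proof.
move=> GB; have mB := sigma_all_measurable chain GB.
pose kk j i := if (i < n)%N then k i else j.
pose F1 m w := ind B w * \sum_(j < m) (z ^+ j * ind (increments n.+1 tau (kk j)) w).
pose F2 m w := ind B w * \sum_(j < m) (z ^+ j * (weights n.+1 tau (kk j) w)%:C).
have bI j : bmf (ind (increments n.+1 tau (kk j))).
  by apply: bmf_ind; exact: measurable_increments.
have b1 (j : nat) : bmf (fun w => ind B w * ind (increments n.+1 tau (kk j)) w).
  by apply: bmfM => //; exact: bmf_ind.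
have b2 (j : nat) : bmf (fun w => ind B w * (weights n.+1 tau (kk j) w)%:C).
  by apply: bmfM; [exact: bmf_ind|exact: bmf_weights].
have sumE (f : nat -> T -> R[i]) m : (forall j, bmf (fun w => ind B w * f j w)) ->
    cE P (fun w => ind B w * \sum_(j < m) (z ^+ j * f j w)) =
    \sum_(j < m) z ^+ j * cE P (fun w => ind B w * f j w).
  move=> bf; under [RHS]eq_bigr => j _ do rewrite -cEZ//.
  rewrite -cE_sum; last by move=> j; apply: bmfM; [exact: bmf_cst|exact: bf].
  by apply: eq_cE => w; rewrite mulr_sumr; apply: eq_bigr => j _; rewrite mulrCA.
have F12 m : cE P (F1 m) = cE P (F2 m).
  rewrite /F1 /F2 (sumE (fun j => ind (increments n.+1 tau (kk j))))//.
  rewrite (sumE (fun j w => (weights n.+1 tau (kk j) w)%:C))//.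
  by apply: eq_bigr => j _; rewrite cE_increments.
(* At most one [j] is the actual increment, and the subtraction in [nat] is a true difference
   because [N] is nondecreasing. *)
have F1E m w : \sum_(j < m) (z ^+ j * ind (increments n.+1 tau (kk j)) w) =
    if (N (tau n.+1) w - N (tau n) w < m)%N then
      ind (increments n tau k) w * z ^+ (N (tau n.+1) w - N (tau n) w) else 0.
  have le_N := count_le w (tau_ge0 n) (tauS n).
  have kkT : increments n.+1 tau (kk (N (tau n.+1) w - N (tau n) w)%N) w <->
      increments n tau k w.
    split=> h i.
      move=> ni; have := h i (leqW ni); by rewrite /kk ni.
    rewrite ltnS leq_eqVlt => /predU1P[->|ni]; last by rewrite /kk ni; exact: h.
    by rewrite /kk ltnn subnKC.
  have kkF j : j != (N (tau n.+1) w - N (tau n) w)%N ->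
      ind (increments n.+1 tau (kk j)) w = 0.
    move=> jN; rewrite cindF// => /(_ n (ltnSn n)); rewrite /kk ltnn => E.
    by rewrite E addKn eqxx in jN.
  case: ifPn => [Nm|Nm]; last first.
    rewrite big1// => j _; rewrite kkF ?mulr0//; apply: contra Nm => /eqP <-.
    exact: ltn_ord.
  rewrite (bigD1 (Ordinal Nm))//= big1 ?addr0 => [|j]; last first.
    by rewrite -val_eqE/= => jN; rewrite kkF ?mulr0.
  rewrite mulrC; congr (_ * _).
  have [h|h] := pselect (increments n tau k w).
    by rewrite !cindT//; apply/kkT.
  by rewrite !cindF//; move/kkT.
have C1 : ccvg (fun m => cE P (F1 m)) (cE P (fun w => ind B w *
    (ind (increments n tau k) w * z ^+ (N (tau n.+1) w - N (tau n) w)))).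
  apply: (@cE_cvg _ _ _ _ _ _ 2).
  - move=> m; apply: bmfM; first exact: bmf_ind.
    by apply: bmf_sum => j; apply: bmfM => //; exact: bmf_cst.
  - move=> m w; apply: cabs_indM; rewrite F1E; case: ifP => _.
      by apply: cabs_indM; exact: cabs_expiX.
    by rewrite /cabs/= normr0 addr0.
  - move=> w; apply: ccvgM; first exact: ccvg_cst.
    apply: ccvg_near; exists (N (tau n.+1) w - N (tau n) w).+1 => // m /= Nm.
    by rewrite F1E Nm.
have wE j w : weights n.+1 tau (kk j) w =
    weights n tau k w * poisson_weight (Lam (tau n) (tau n.+1) w) j.
  rewrite /weights big_ord_recr/= /kk ltnn; congr (_ * _).
  by apply: eq_bigr => i _; rewrite ltn_ord.
have F2E m w : \sum_(j < m) (z ^+ j * (weights n.+1 tau (kk j) w)%:C) =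
    (weights n tau k w)%:C *
    \sum_(j < m) (z ^+ j * (poisson_weight (Lam (tau n) (tau n.+1) w) j)%:C).
  by rewrite mulr_sumr; apply: eq_bigr => j _; rewrite wE rmorphM mulrCA.
have C2 : ccvg (fun m => cE P (F2 m)) (cE P (fun w => ind B w *
    ((weights n tau k w)%:C * poisson_cf u (Lam (tau n) (tau n.+1) w)))).
  apply: (@cE_cvg _ _ _ _ _ _ 2).
  - move=> m; apply: bmfM; first exact: bmf_ind.
    by apply: bmf_sum => j; apply: bmfM; [exact: bmf_cst|exact: bmf_weights].
  - move=> m w; apply: cabs_indM; rewrite F2E (le_trans (cabsM _ _))// cabs_real.
    have /andP[w0 w1] := weights_bound n k w.
    have L0 := cumulated_intensity_ge0 lambda_ge0 chain (tau n.+1) w (tau_ge0 n).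
    rewrite -[leRHS]mul1r ler_pM ?cabs_ge0 ?ger0_norm//.
    rewrite (le_trans (cabs_sum _ _))//.
    apply: (@le_trans _ _ (2 * \sum_(j < m) poisson_weight (Lam (tau n) (tau n.+1) w) j)).
      rewrite mulr_sumr; apply: ler_sum => j _; rewrite (le_trans (cabsM _ _))//.
      rewrite cabs_real ger0_norm ?poisson_weight_ge0// ler_wpM2r ?poisson_weight_ge0//.
      exact: cabs_expiX.
    by rewrite -[leRHS]mulr1 ler_wpM2l// sum_poisson_weight_le.
  - move=> w; apply: ccvgM; first exact: ccvg_cst.
    apply: eq_ccvg (ccvgM (ccvg_cst _) (poisson_gf u (Lam (tau n) (tau n.+1) w))) => m.
    by rewrite F2E.
apply: ccvg_unique C1 _; apply: eq_ccvg C2 => m.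
by rewrite F12.
Qed.

Local Notation E n := (expmx ((tau n.+1 - tau n)%:C *: mmpp_generator Q lambda u)).

(** The event on increments is traded for its weights and the power of z for [poisson_cf]; the state
    at [tau n.+1] is allowed there, since [cE_increments_cf] accepts any event of [sigma_all X].
    Feynman-Kac then leads back to time [tau n], and the weights are traded back on each state event
    at that time. *)
Lemma cE_increments_state n k (A : set T) j : sigma_upto X (tau n) A ->
  cE P (fun w => ind A w * (ind (increments n tau k) w *
    (z ^+ (N (tau n.+1) w - N (tau n) w) * ind (ev (tau n.+1) j) w))) =
  cE P (fun w => ind A w * (ind (increments n tau k) w *
    \sum_i E n j i * ind (ev (tau n) i) w)).
Proof.
move=> GA; have tn := tau_ge0 n; have tn1 := tau_ge0 n.+1.
have GA' := sigma_upto_all GA.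
have Gev r i : 0 <= r -> sigma_all X (ev r i).
  by move=> r0; apply: (@sigma_upto_all _ _ _ _ _ r); exact: state_event_upto.
have mA := sigma_upto_measurable chain GA.
have Hs i : cE P (fun w => ind (A `&` ev (tau n) i) w * ind (increments n tau k) w) =
    cE P (fun w => ind (A `&` ev (tau n) i) w * (weights n tau k w)%:C).
  by apply: cE_increments; apply: sigma_allI => //; exact: Gev.
have Ht := @cE_increments_cf n k _ (sigma_allI GA' (Gev (tau n.+1) j tn1)).
have bf : bmf (fun w => ind (ev (tau n.+1) j) w * poisson_cf u (Lam (tau n) (tau n.+1) w)).
  apply: bmfM; first exact: (bmf_state chain).
  exact: (bmf_poisson_cf_cumulated u lambda_ge0 chain).
have bg : bmf (fun w => \sum_i E n j i * ind (ev (tau n) i) w).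
  by apply: bmf_sum => i; apply: bmfM; [exact: bmf_cst|exact: (bmf_state chain)].
(* [feynman_kac] is stated for events of the past. [A] and the weights form one weight with values
   in [0, 1], known at time [tau n], to which [cE_weight] extends it. *)
pose W w := \1_A w * weights n tau k w.
have WW : cE P (fun w => (W w)%:C * (ind (ev (tau n.+1) j) w *
      poisson_cf u (Lam (tau n) (tau n.+1) w))) =
    cE P (fun w => (W w)%:C * \sum_i E n j i * ind (ev (tau n) i) w).
  apply: (@cE_weight _ _ _ P (sigma_upto X (tau n))) => //.
  - exact: (@sigma_upto_measurable _ _ _ P _ _ _ chain).
  - move=> B mB.
    have mW : measurable_fun (setT : set (g_sigma_algebraType (history X `[0, tau n]))) W.
      by apply: measurable_funM; [exact: measurable_indic|exact: measurable_weights].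
    by have := mW measurableT B mB; rewrite setTI.
  - move=> w; rewrite /W; have /andP[w0 w1] := weights_bound n k w.
    rewrite indicE; case: (_ \in _); rewrite ?mul1r ?mul0r ?w0 ?w1//.
    by rewrite lexx ler01.
  - by move=> A' GA''; exact: (feynman_kac u lambda_ge0 chain).
transitivity (cE P (fun w => ind (A `&` ev (tau n.+1) j) w *
    (ind (increments n tau k) w * z ^+ (N (tau n.+1) w - N (tau n) w)))).
  by apply: eq_cE => w; rewrite cindI; ring.
rewrite Ht.
transitivity (cE P (fun w => (W w)%:C * (ind (ev (tau n.+1) j) w *
      poisson_cf u (Lam (tau n) (tau n.+1) w)))).
  by apply: eq_cE => w; rewrite cindI /W rmorphM/= /cind; ring.
rewrite WW.
have sumE (f : T -> R[i]) : bmf f ->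
    cE P (fun w => ind A w * (f w * \sum_i E n j i * ind (ev (tau n) i) w)) =
    \sum_i E n j i * cE P (fun w => ind (A `&` ev (tau n) i) w * f w).
  move=> bf'; have bb i : bmf (fun w => ind (A `&` ev (tau n) i) w * f w).
    apply: bmfM => //; apply: bmf_ind; apply: measurableI => //.
    exact: (measurable_state_event chain).
  under [RHS]eq_bigr => i _ do rewrite -cEZ//.
  rewrite -cE_sum; last by move=> i; apply: bmfM => //; exact: bmf_cst.
  apply: eq_cE => w; rewrite !mulr_sumr; apply: eq_bigr => i _.
  by rewrite cindI; ring.
rewrite sumE; last by apply: bmf_ind; exact: measurable_increments.
under [RHS]eq_bigr => i _ do rewrite Hs.
rewrite -sumE; last exact: bmf_weights.
by apply: eq_cE => w; rewrite /W rmorphM/= /cind; ring.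
Qed.

End grid.
End poisson_cylinders.

(** * From cylinders to the joint history *)

Section joint_history.
Context {R : realType} {dis : measure_display} {T : measurableType dis}.
Variable P : probability T R.
Context {d : nat}.
Variables (Q : 'M[R]_d) (lambda : 'cV[R]_d) (X : R -> T -> 'cV[R]_d)
  (N : R -> T -> nat) (u s t : R).
Hypothesis lambda_ge0 : forall j, 0 <= lambda j 0.
Hypothesis mmpp : is_mmpp P Q lambda X N.
Hypotheses (s0 : 0 <= s) (st : s <= t).

Local Notation ev := (state_event X).
Local Notation ind := (@cind R _ T).
Local Notation z := (expi u).
Local Notation E := (expmx ((t - s)%:C *: mmpp_generator Q lambda u)).

Let chain := mmpp_chain mmpp.
Let t0 : 0 <= t := le_trans s0 st.

Definition count_cylinder (l : seq (R * nat)) : set T :=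
  [set w | forall rv, rv \in l -> N rv.1 w = rv.2].

(** 0 is added because N_0 = 0 turns counts into increments, and [s] because the last increment
    before [t] must start there. Repeated times only give increments over intervals of length 0. *)
Let times (l : seq (R * nat)) := sort <=%O (0 :: s :: map fst l).
(** The default value of [nth] makes [t] the grid point that follows [s], and keeps the infinite
    sequence constant from there on. *)
Let grid l i := nth t (times l) i.

Section grid_of_times.
Variable l : seq (R * nat).
Hypothesis ls : forall rv, rv \in l -> 0 <= rv.1 <= s.

Let p := (size l).+1.

Let size_times : size (times l) = p.+1.
Proof. by rewrite size_sort/= size_map. Qed.

Let times_bound r : r \in times l -> 0 <= r <= s.
Proof.
rewrite mem_sort !inE => /or3P[/eqP ->|/eqP ->|/mapP[rv /ls rvs ->]] //.
  by rewrite lexx.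
by rewrite s0 lexx.
Qed.

Let grid_in i : (i <= p)%N -> grid l i \in times l.
Proof. by move=> ip; apply: mem_nth; rewrite size_times. Qed.

Let grid_le i j : (i <= j <= p)%N -> grid l i <= grid l j.
Proof.
move=> /andP[ij jp].
apply: (sorted_leq_nth le_trans le_refl t (sort_sorted le_total _)) => //;
  rewrite inE -/(times l) size_times ltnS//.
exact: leq_trans jp.
Qed.

Let grid_t i : (p < i)%N -> grid l i = t.
Proof. by move=> pi; rewrite /grid nth_default// size_times. Qed.

Let grid_index r : r \in times l -> exists2 i, (i <= p)%N & grid l i = r.
Proof.
move=> rl; exists (index r (times l)); last exact: nth_index.
by rewrite -ltnS -size_times index_mem.
Qed.

Lemma grid0 : grid l 0 = 0.
Proof.
have [i ip i0] : exists2 i, (i <= p)%N & grid l i = 0.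
  by apply: grid_index; rewrite mem_sort inE eqxx.
apply/eqP; rewrite eq_le; have /times_bound/andP[-> _] := grid_in (leq0n p).
by rewrite andbT -i0 grid_le.
Qed.

Lemma grid_s : grid l p = s.
Proof.
have [i ip is_] : exists2 i, (i <= p)%N & grid l i = s.
  by apply: grid_index; rewrite mem_sort !inE eqxx orbT.
apply/eqP; rewrite eq_le; have /times_bound/andP[_ ->] := grid_in (leqnn p).
by rewrite -[in s <= _]is_ grid_le// ip leqnn.
Qed.

Lemma gridS i : grid l i <= grid l i.+1.
Proof.
have [ip|pi] := ltnP i p; first by apply: grid_le; rewrite leqnSn.
rewrite [leRHS]grid_t//; move: pi; rewrite leq_eqVlt => /predU1P[<-|/grid_t -> //].
by rewrite grid_s.
Qed.

(* Every grid time other than 0 has its count prescribed by the cylinder, so a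
   nonempty cylinder is an event on the increments along the sorted grid. *)
Lemma count_cylinder_increments m w0 :
  count_cylinder l w0 -> N s w0 = m -> exists k,
  N s @^-1` [set m] `&` count_cylinder l = increments N p (grid l) k.
Proof.
move=> lw0 sw0.
have zero w : N 0 w = 0%N by have [] := mmpp_counting mmpp w.
have grid_ge0 i : 0 <= grid l i by apply: tau_ge0 => //; [rewrite grid0|exact: gridS].
(* The prescribed increments are those of the sample point [w0]: every point of the event has the
   counts of [w0] at all grid times up to [s]. *)
exists (fun i => N (grid l i.+1) w0 - N (grid l i) w0)%N.
apply/seteqP; split => w.
  move=> [/= sw lw] i ip.
  have same j : (j <= p)%N -> N (grid l j) w = N (grid l j) w0.
    move=> /grid_in; rewrite mem_sort !inE.
    move=> /or3P[/eqP ->|/eqP ->|/mapP[rv rvl ->]]; first by rewrite !zero.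
      by rewrite sw sw0.
    by rewrite lw ?lw0.
  rewrite !same//; last exact: ltnW.
  by rewrite subnKC// (count_le mmpp) ?gridS.
move=> iw.
have same j : (j <= p)%N -> N (grid l j) w = N (grid l j) w0.
  elim: j => [|j IH] jp; first by rewrite grid0 !zero.
  by rewrite iw// IH 1?ltnW// subnKC// (count_le mmpp) ?gridS.
split=> /= [|rv rvl]; first by rewrite -grid_s same// grid_s.
have [i ip ir] : exists2 i, (i <= p)%N & grid l i = rv.1.
  by apply: grid_index; rewrite mem_sort !inE map_f ?orbT.
by rewrite -ir same// ir lw0.
Qed.

Lemma grid_end : grid l p.+1 = t.
Proof. exact: grid_t. Qed.

End grid_of_times.

Definition terminal_value j w : R[i] := z ^+ N t w * ind (ev t j) w.

Definition predicted_value j w : R[i] := \sum_i E j i * (z ^+ N s w * ind (ev s i) w).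

Lemma bmf_expi_count r : 0 <= r -> bmf (fun w => z ^+ N r w).
Proof.
move=> r0; apply: (@bmf_count _ _ _ (N r) (fun m => z ^+ m) 2) => m.
  exact: (measurable_count mmpp).
exact: cabs_expiX.
Qed.

Lemma bmf_terminal j : bmf (terminal_value j).
Proof. by apply: bmfM; [exact: bmf_expi_count|exact: (bmf_state chain)]. Qed.

Lemma bmf_predicted j : bmf (predicted_value j).
Proof.
apply: bmf_sum => i; apply: bmfM; first exact: bmf_cst.
by apply: bmfM; [exact: bmf_expi_count|exact: (bmf_state chain)].
Qed.

Lemma measurable_count_cylinder l : (forall rv, rv \in l -> 0 <= rv.1 <= s) ->
  measurable (count_cylinder l).
Proof.
elim: l => [_|rv l IH ls].
  rewrite (_ : count_cylinder [::] = setT)//.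
  by apply/seteqP; split => // w _ rv; rewrite in_nil.
rewrite (_ : count_cylinder _ = N rv.1 @^-1` [set rv.2] `&` count_cylinder l).
  apply: measurableI; last by apply: IH => rv' h; apply: ls; rewrite inE h orbT.
  by apply: (measurable_count mmpp); have /andP[] := ls rv (mem_head _ _).
apply/seteqP; split => w.
  move=> h; split; first exact: (h _ (mem_head _ _)).
  by move=> rv' rl; apply: h; rewrite inE rl orbT.
by move=> [/= h1 h2] rv'; rewrite inE => /predU1P[->//|/h2].
Qed.

(** On N_s = m the factor e^(iu N_s) is the constant z^m, so both sides come from
    [cE_increments_state] multiplied by z^m. An empty event is set aside, since the prescribed
    increments are read off one of its points. *)
Lemma cE_cylinder A l m j : (forall rv, rv \in l -> 0 <= rv.1 <= s) ->
  sigma_upto X s A ->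
  cE P (fun w => ind (N s @^-1` [set m]) w *
    (ind (A `&` count_cylinder l) w * terminal_value j w)) =
  cE P (fun w => ind (N s @^-1` [set m]) w *
    (ind (A `&` count_cylinder l) w * predicted_value j w)).
Proof.
move=> ls GA; set S := N s @^-1` [set m].
have arr f w : ind S w * (ind (A `&` count_cylinder l) w * f w) =
    ind A w * (ind (S `&` count_cylinder l) w * f w).
  by rewrite !cindI; ring.
rewrite (eq_cE P (arr _)) (eq_cE P (arr _)).
have [[w0 [sw0 lw0]]|no] := pselect (exists w, (S `&` count_cylinder l) w); last first.
  apply: eq_cE => w; rewrite (cindF (A := S `&` _)) ?mul0r//.
  by move=> h; apply: no; exists w.
have [k Sk] := count_cylinder_increments ls lw0 sw0.
rewrite -/S in Sk; rewrite Sk.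
set p := (size l).+1 in Sk *.
have g0 : 0 <= grid l 0 by rewrite grid0.
have gS i := gridS ls i.
have gp : grid l p = s by exact: grid_s.
have gp1 : grid l p.+1 = t by exact: grid_end.
have mA := sigma_upto_measurable chain GA.
have mI := measurable_increments mmpp g0 gS p k.
have Sm w : increments N p (grid l) k w -> N s w = m by rewrite -Sk => -[].
have := @cE_increments_state _ _ _ P _ _ lambda X N u lambda_ge0 mmpp _ g0 gS p k A j.
rewrite gp gp1 => /(_ GA) /(congr1 (fun x => z ^+ m * x)).
rewrite -!cEZ; last 2 first.
- apply: bmfM; first exact: bmf_ind.
  apply: bmfM; first exact: bmf_ind.
  by apply: bmf_sum => i; apply: bmfM; [exact: bmf_cst|exact: (bmf_state chain)].
- apply: bmfM; first exact: bmf_ind.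
  apply: bmfM; first exact: bmf_ind.
  apply: bmfM; last exact: (bmf_state chain).
  apply: (@bmf_count _ _ _ (fun w => N t w - N s w)%N (fun m => z ^+ m) 2) => i.
    exact: (measurable_count_diff mmpp).
  exact: cabs_expiX.
have pull (f g : T -> R[i]) : (forall w, N s w = m -> f w = z ^+ m * g w) ->
    cE P (fun w => ind A w * (ind (increments N p (grid l) k) w * f w)) =
    cE P (fun w => z ^+ m * (ind A w * (ind (increments N p (grid l) k) w * g w))).
  move=> fg; apply: eq_cE => w.
  have [h|h] := pselect (increments N p (grid l) k w).
    by rewrite fg ?Sm//; ring.
  by rewrite (cindF h) !mul0r !mulr0.
move=> eq_cylinder; apply: etrans (etrans _ eq_cylinder) _.
  apply: pull => w sw; rewrite /terminal_value mulrA -exprD -{1}sw subnKC//.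
  exact: (count_le mmpp).
apply/esym/pull => w sw; rewrite /predicted_value mulr_sumr; apply: eq_bigr => i _.
by rewrite sw mulrCA.
Qed.

(** Only [N] is restricted to finitely many times: [A] may be any event of the past of [X], as in
    [cE_increments_state]. *)
Definition joint_cylinders : set (set T) :=
  [set B | exists A l, [/\ sigma_upto X s A, (forall rv, rv \in l -> 0 <= rv.1 <= s)
    & B = A `&` count_cylinder l]].

Lemma joint_cylindersI : setI_closed joint_cylinders.
Proof.
move=> _ _ [A [l [GA ls ->]]] [A' [l' [GA' ls' ->]]].
exists (A `&` A'), (l ++ l'); split; first exact: sigma_uptoI.
  by move=> rv; rewrite mem_cat => /orP[/ls|/ls'].
rewrite setIACA; congr (_ `&` _); apply/seteqP; split => w.
  by move=> [h h'] rv; rewrite mem_cat => /orP[/h|/h'].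
by move=> h; split=> rv rl; apply: h; rewrite mem_cat rl ?orbT.
Qed.

Lemma count_cylinder_nil : count_cylinder [::] = setT.
Proof. by apply/seteqP; split. Qed.

Lemma joint_filtration_cylinders : joint_filtration X N s `<=` <<s joint_cylinders >>.
Proof.
apply: sub_sigma_algebra2 => A [GA|[r [m [/= rs ->]]]].
  exists A, [::]; split => //; first exact: sub_sigma_algebra.
  by rewrite count_cylinder_nil setIT.
exists setT, [:: (r, m)]; split.
- exact: (@measurableT _ (g_sigma_algebraType (history X `[0, s]))).
- by move=> rv; rewrite inE => /eqP ->; move: rs; rewrite in_itv.
- rewrite setTI; apply/seteqP; split => w /=.
    by move=> h rv; rewrite inE => /eqP ->.
  by move=> /(_ (r, m)); apply; rewrite inE.
Qed.

Lemma joint_filtration_measurable : joint_filtration X N s `<=` measurable.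
Proof.
apply: smallest_sub; first exact: sigma_algebra_measurable.
move=> A [GA|[r [m [/= rs ->]]]].
  by apply: (@sigma_upto_measurable _ _ _ P _ _ _ chain s); exact: sub_sigma_algebra.
by apply: (measurable_count mmpp); move: rs; rewrite in_itv/= => /andP[].
Qed.

Lemma cE_joint A j : joint_filtration X N s A ->
  cE P (fun w => ind A w * terminal_value j w) =
  cE P (fun w => ind A w * predicted_value j w).
Proof.
have mC : joint_cylinders `<=` measurable.
  move=> _ [B [l [GB ls ->]]]; apply: measurableI.
    exact: (@sigma_upto_measurable _ _ _ P _ _ _ chain s).
  exact: measurable_count_cylinder.
move=> /joint_filtration_cylinders; apply: cE_pi_lambda => //.
- exact: joint_cylindersI.
- exists setT, [::]; split => //; last by rewrite count_cylinder_nil setIT.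
  exact: (@measurableT _ (g_sigma_algebraType (history X `[0, s]))).
- exact: bmf_terminal.
- exact: bmf_predicted.
move=> _ [B [l [GB ls ->]]].
have bI f : bmf f -> bmf (fun w => ind (B `&` count_cylinder l) w * f w).
  by move=> bf; apply: bmfM => //; apply: bmf_ind; apply: mC; exists B, l.
(* A cylinder need not prescribe N_s; splitting on its value reduces to [cE_cylinder]. *)
apply: (@cE_countable _ _ _ P (N s)).
- by move=> m; exact: (measurable_count mmpp).
- by apply: bI; exact: bmf_terminal.
- by apply: bI; exact: bmf_predicted.
- by move=> m; exact: cE_cylinder.
Qed.

(* predicted_value is measurable for the joint history because it is a bounded
   measurable function on the type carrying that sigma-algebra. *)
Lemma bmf_predicted_joint j :
  @bounded_measurable R _
    (g_sigma_algebraType (history X `[0, s] `|` history N `[0, s])) (predicted_value j).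
Proof.
pose T' := g_sigma_algebraType (history X `[0, s] `|` history N `[0, s]).
apply: (@bmf_sum _ _ T') => i; apply: (@bmfM _ _ T'); first exact: bmf_cst.
apply: (@bmfM _ _ T').
  apply: (@bmf_count _ _ T' (N s) (fun m => z ^+ m) 2) => m; last exact: cabs_expiX.
  apply: sub_sigma_algebra; right; exists s, m; split => //=.
  by rewrite in_itv/= s0 lexx.
apply: (@bmf_ind _ _ T'); apply: sub_sigma_algebra; left.
by exists s, (delta_mx i 0); split => //=; rewrite in_itv/= s0 lexx.
Qed.

(** [h] treats the real and imaginary parts at once: both commute with [cE] and with multiplication
    by an indicator. *)
Lemma is_condexp_predicted (h : R[i] -> R) j :
  h = @complex.Re R \/ h = @complex.Im R ->
  is_condexp P (joint_filtration X N s) (fun w => h (terminal_value j w))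
    (fun w => h (predicted_value j w)).
Proof.
move=> hRI.
have hint f : bmf f -> P.-integrable setT (EFin \o (fun w => h (f w))).
  by move=> bf; have [i1 i2] := @bmf_integrable _ _ _ P f bf; case: hRI => ->.
have hE A f : measurable A -> h (cE P (fun w => ind A w * f w)) =
    fine (\int[P]_(w in A) (h (f w))%:E).
  move=> mA; rewrite -/(Rintegral P A (fun w => h (f w))) Rintegral_mkcond.
  case: hRI => ->; apply: eq_Rintegral => w _; rewrite patchE /cind indicE ?cReM ?cImM/=;
    by case: (_ \in _); rewrite ?mul1r !mul0r ?subr0 ?addr0.
split.
- exact: (hint _ (bmf_terminal j)).
- exact: (hint _ (bmf_predicted j)).
- move=> B mB; have [m1 m2 _] := bmf_predicted_joint j.
  have : measurable_fun (setT : set (g_sigma_algebraType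
      (history X `[0, s] `|` history N `[0, s]))) (fun w => h (predicted_value j w)).
    by case: hRI => ->.
  by move=> /(_ measurableT B mB); rewrite setTI.
- move=> A GA; have mA := joint_filtration_measurable GA.
  have fin f : bmf f -> (\int[P]_(w in A) (h (f w))%:E)%E \is a fin_num.
    move=> bf; apply: integrable_fin_num => //.
    by apply: integrableS (hint _ bf).
  rewrite -[LHS]fineK ?fin//; last exact: bmf_predicted.
  rewrite -[RHS]fineK ?fin//; last exact: bmf_terminal.
  by rewrite -!hE// cE_joint.
Qed.

End joint_history.

(** * Almost sure uniqueness of conditional expectations *)

Section condexp_uniqueness.
Context {R : realType} {dis : measure_display} {T : measurableType dis}.
Variable P : probability T R.

(** For two versions f and g, the event f > g belongs to the sigma-algebra, so both have the same
    integral over it; f - g is positive there, hence the event is null. Exchanging f and g gives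
    equality. *)
Lemma condexp_unique (H : set (set T)) (Y Z Z' : T -> R) :
  <<s H >> `<=` measurable -> is_condexp P <<s H >> Y Z -> is_condexp P <<s H >> Y Z' ->
  {ae P, forall w, Z w = Z' w}.
Proof.
move=> Hm.
have le_ae (f g : T -> R) : is_condexp P <<s H >> Y f -> is_condexp P <<s H >> Y g ->
    {ae P, forall w, f w <= g w}.
  move=> [_ intf mf fE] [_ intg mg gE].
  pose T' := g_sigma_algebraType H.
  have mfg : measurable_fun (setT : set T') (fun w => f w - g w).
    by apply: measurable_funB => _ B mB; rewrite setTI; [exact: mf|exact: mg].
  pose D : set T := [set w | 0 < f w - g w].
  have GD : <<s H >> D.
    have := mfg measurableT `]0, +oo[%classic (measurable_itv _); rewrite setTI.
    rewrite (_ : _ @^-1` _ = D)//.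
    by apply/seteqP; split => w /=; rewrite in_itv/= andbT.
  have mD := Hm _ GD.
  have intfD : P.-integrable D (EFin \o f) by apply: integrableS intf.
  have intgD : P.-integrable D (EFin \o g) by apply: integrableS intg.
  have mDfg : measurable_fun D (fun w => (f w - g w)%:E).
    by have /integrableP[] := integrableB mD intfD intgD.
  have int0 : (\int[P]_(w in D) `|(f w - g w)%:E|)%E = 0%E.
    transitivity (\int[P]_(w in D) ((f w)%:E - (g w)%:E))%E.
      by apply: eq_integral => w; rewrite inE => Dw; rewrite gee0_abs ?lee_fin ?ltW.
    rewrite integralB_EFin// fE// gE// subee// -fE//.
    exact: integrable_fin_num.
  have /(ae_eq_integral_abs _ mD mDfg) := int0.
  apply: filterS => w Dw; rewrite leNgt; apply/negP => gf.
  have Dw' : D w by rewrite /D/= subr_gt0.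
  by have [] := Dw Dw' => /eqP; rewrite gt_eqF.
move=> cZ cZ'; have := le_ae _ _ cZ' cZ; have := le_ae _ _ cZ cZ'.
by apply: filterS2 => w h1 h2; apply/eqP; rewrite eq_le h1 h2.
Qed.

End condexp_uniqueness.

Unset Implicit Arguments.

Theorem proposition3p2 (R : realType) (dis : measure_display)
    (T : measurableType dis) (P : probability T R)
    (d : nat) (Q : 'M[R]_d) (lambda : 'cV[R]_d)
    (X : R -> T -> 'cV[R]_d) (N : R -> T -> nat)
    (hQ : is_rate_matrix Q) (hirr : irreducible_rate Q)
    (hlambda : forall j : 'I_d, 0 <= lambda j 0)
    (hXN : is_mmpp P Q lambda X N)
    (s t u : R) (hs : 0 <= s) (hst : s <= t) :
  let Y := fun w : T => expi (u * (N t w)%:R) *: complex_mx (X t w) in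
  let rhs := fun w : T =>
    expmx ((t - s)%:C *: ((expi u - 1) *: complex_mx (diag_mx lambda^T)
                          + complex_mx Q))
      *m (expi (u * (N s w)%:R) *: complex_mx (X s w)) in
  is_condexp_vec P (joint_filtration X N s) Y rhs /\
  (forall phi : T -> 'cV[R[i]]_d,
     is_condexp_vec P (joint_filtration X N s) Y phi ->
     {ae P, forall w, phi w = rhs w}).
Proof.
move=> Y rhs.
have ht : 0 <= t := le_trans hs hst.
have chain := mmpp_chain hXN.
(* Coordinate [j] of [X t] is the indicator of state [j], which reduces the vector statement to the
   scalar one. *)
have YE j w : Y w j 0 = terminal_value X N u t j w.
  by rewrite !mxE expi_natr /terminal_value (cind_state chain).
have rhsE j w : rhs w j 0 = predicted_value Q lambda X N u s t j w.
  rewrite /rhs mxE; apply: eq_bigr => i _.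
  by rewrite !mxE expi_natr (cind_state chain).
have Yrhs : is_condexp_vec P (joint_filtration X N s) Y rhs.
  have eqY (h : R[i] -> R) j :
      (fun w => h (Y w j 0)) = (fun w => h (terminal_value X N u t j w)).
    by apply/funext => w; rewrite YE.
  have eqrhs (h : R[i] -> R) j :
      (fun w => h (rhs w j 0)) = (fun w => h (predicted_value Q lambda X N u s t j w)).
    by apply/funext => w; rewrite rhsE.
  move=> j; rewrite !(eqY, eqrhs).
  by split; apply: (is_condexp_predicted u hlambda hXN hs hst); [left|right].
split=> // phi Yphi.
have joint_measurable := joint_filtration_measurable (s := s) hXN.
(* Finitely many null sets are discarded, two for each coordinate. *)
have ae_entries : {ae P, forall w, forall j, phi w j 0 = rhs w j 0}.
  apply: filter_forall => j; have [phiR phiI] := Yphi j; have [rhsR rhsI] := Yrhs j.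
  apply: filterS2 (condexp_unique joint_measurable phiR rhsR)
    (condexp_unique joint_measurable phiI rhsI) => w.
  exact: complexP.
by apply: filterS ae_entries => w h; apply/matrixP => i j; rewrite (ord1 j).
Qed.
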